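(* Let $\mathbb{K}$ be a commutative ring, $\mathbb{G}$ an abelian group, and $F$ a quasi-free $\mathbb{G}$-graded $\mathbb{K}$-algebra. Let $I$ be a two-sided homogeneous ideal of $F$, $J$ a right homogeneous ideal of $F$, and $J'$ a left homogeneous ideal of $F$ such that $I\subseteq J$ and $I\subseteq J'$. Assume that $F/I$ and $F/J$ are projective $\mathbb{K}$-modules, and set $A=F/I$, $S=F/J$, $S'=F/J'$. Then for every $n\geq 0$ there are isomorphisms of graded modules $$\mathrm{Tor}^A_{2n,*}(S,S')\cong \frac{I^n\cap JI^{n-1}J'}{JI^n+I^nJ'},\qquad \mathrm{Tor}^A_{2n+1,*}(S,S')\cong\frac{JI^n\cap I^nJ'}{I^{n+1}+JI^nJ'},$$ where $I^0=F$, and for $n=0$ the numerator $I^n\cap JI^{n-1}J'$ is understood to be $F$.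
   Context: All algebras are unital and associative; graded means $\mathbb{G}$-graded. A graded $\mathbb{K}$-algebra $F$ is called quasi-free if the projective dimension of $F$ in the category of graded $F$-bimodules (identified with right graded modules over $F^{op}\otimes_{\mathbb{K}}F$) is at most one. Equivalently, $\Omega^1_F=\mathrm{Ker}(F\otimes_{\mathbb K} F\to F,\ a\otimes b\mapsto ab)$ is a projective graded $F$-bimodule. For a graded algebra $A$, a right graded $A$-module $M$ and a left graded $A$-module $M'$, the bigraded Tor functor is $\mathrm{Tor}^A_{n,g}(M,M')=(H_n(P_\bullet\otimes_A M'))_g$ for $n\in\mathbb{Z}$, $g\in\mathbb{G}$, where $P_\bullet$ is a graded projective resolution of $M$ and $\otimes_A$ is the graded tensor product. The graded module with components $\mathrm{Tor}^A_{n,g}(M,M')$, $g\in \mathbb G$, is denoted $\mathrm{Tor}^A_{n,*}(M,M')$. *)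

(* Defs.v *)
From HB Require Import structures.
From mathcomp Require Import all_boot all_order all_algebra.
From mathcomp Require Import finmap.
From mathcomp Require Import boolp classical_sets functions cardinality fsbigop.

Set Implicit Arguments.
Unset Strict Implicit.
Unset Printing Implicit Defensive.

Import GRing.Theory.
Local Open Scope classical_set_scope.
Local Open Scope ring_scope.
Local Open Scope quotient_scope.

Record submod (K : pzRingType) (V : lmodType K) := Submod {
  sm_set :> V -> Prop;
  sm_0 : sm_set 0;
  sm_lin : forall (k : K) (x y : V), sm_set x -> sm_set y -> sm_set (k *: x + y)
}.

Section SubmodTheory.
Variables (K : pzRingType) (V : lmodType K).
Implicit Types (W U : submod V) (S : set V).

Lemma smD W x y : W x -> W y -> W (x + y).
Proof. by move=> Wx Wy; rewrite -[x]scale1r; exact: sm_lin. Qed.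

Lemma smZ W k x : W x -> W (k *: x).
Proof. by move=> Wx; rewrite -[k *: x]addr0; apply: sm_lin => //; exact: sm_0. Qed.

Lemma smN W x : W x -> W (- x).
Proof. by move=> Wx; rewrite -scaleN1r; exact: smZ. Qed.

Lemma smB W x y : W x -> W y -> W (x - y).
Proof. by move=> Wx Wy; apply: smD => //; exact: smN. Qed.

Definition sm_top : submod V :=
  @Submod K V setT Logic.I (fun _ _ _ _ _ => Logic.I).

Fact sm_cap_lin W U k x y :
  (W `&` U) x -> (W `&` U) y -> (W `&` U) (k *: x + y).
Proof. by move=> [? ?] [? ?]; split; exact: sm_lin. Qed.
Definition sm_cap W U : submod V :=
  Submod (conj (sm_0 W) (sm_0 U)) (@sm_cap_lin W U).

Definition span_set S : set V :=
  [set x | forall W, S `<=` W -> W x].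
Fact span_0 S : span_set S 0. Proof. by move=> W _; exact: sm_0. Qed.
Fact span_lin S k x y :
  span_set S x -> span_set S y -> span_set S (k *: x + y).
Proof. by move=> Sx Sy W SW; apply: sm_lin; [exact: Sx|exact: Sy]. Qed.
Definition span S : submod V := Submod (@span_0 S) (@span_lin S).

Definition sm_add W U : submod V := span (W `|` U).

Lemma span_sub S : S `<=` span S.
Proof. by move=> x Sx W; apply. Qed.

Definition sm_pred W : {pred V} := fun x => `[< W x >].
Fact sm_pred_closed W : subsemimod_closed (sm_pred W).
Proof.
split; first split.
- by apply/asboolP; exact: sm_0.
- by move=> x y /asboolP Wx /asboolP Wy; apply/asboolP; exact: smD.
- by move=> k x /asboolP Wx; apply/asboolP; exact: smZ.
Qed.
HB.instance Definition _ W :=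
  GRing.isSubmodClosed.Build K V (sm_pred W) (sm_pred_closed W).

Definition subm W := {x : V | sm_pred W x}.
HB.instance Definition _ W := SubType.on (subm W).
HB.instance Definition _ W := [Choice of subm W by <:].
HB.instance Definition _ W := [SubChoice_isSubLmodule of subm W by <:].

Lemma submP W (x : subm W) : W (val x).
Proof. by case: x => x /= /asboolP. Qed.

Definition quot_rel W : rel V := fun x y => `[< W (x - y) >].
Fact quot_rel_equiv W : equiv_class_of (quot_rel W).
Proof.
split=> [x|x y|y x z].
- by apply/asboolP; rewrite subrr; exact: sm_0.
- by apply/asboolP/asboolP => /smN; rewrite opprB.
- move=> /asboolP Wxy /asboolP Wyz; apply/asboolP.
  by rewrite -[x](subrK y) -addrA; exact: smD.
Qed.
Canonical quot_equiv W := EquivRelPack (quot_rel_equiv W).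

Definition quotm W := {eq_quot quot_equiv W}.
HB.instance Definition _ W := Choice.on (quotm W).
HB.instance Definition _ W := EqQuotient.on (quotm W).

Definition qpi W : V -> quotm W := fun x => \pi_(quotm W) x.

Lemma qpi_eq W x y : qpi W x = qpi W y <-> W (x - y).
Proof.
by split=> [/eqP|Wxy]; rewrite ?[_ == _]eqmodE; [move/asboolP|
  apply/eqP; rewrite eqmodE; apply/asboolP].
Qed.

Lemma qpi_repr W (x : quotm W) : qpi W (repr x) = x.
Proof. exact: reprK. Qed.

Lemma repr_qpi W x : W (repr (qpi W x) - x).
Proof. by apply/qpi_eq; rewrite qpi_repr. Qed.

Section QuotOps.
Variable W : submod V.
Implicit Types x y z : quotm W.

Definition q_add x y := qpi W (repr x + repr y).
Definition q_opp x := qpi W (- repr x).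
Definition q_scale k x := qpi W (k *: repr x).

Fact q_addE u v : q_add (qpi W u) (qpi W v) = qpi W (u + v).
Proof. by apply/qpi_eq; rewrite opprD addrACA; apply: smD; exact: repr_qpi. Qed.
Fact q_oppE u : q_opp (qpi W u) = qpi W (- u).
Proof. by apply/qpi_eq; rewrite -opprD; apply: smN; exact: repr_qpi. Qed.
Fact q_scaleE k u : q_scale k (qpi W u) = qpi W (k *: u).
Proof. by apply/qpi_eq; rewrite -scalerBr; apply: smZ; exact: repr_qpi. Qed.

Fact q_addA : associative q_add.
Proof.
move=> x y z; rewrite -[x]qpi_repr -[y]qpi_repr -[z]qpi_repr.
by rewrite !q_addE addrA.
Qed.
Fact q_addC : commutative q_add.
Proof. by move=> x y; rewrite /q_add addrC. Qed.
Fact q_add0 : left_id (qpi W 0) q_add.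
Proof. by move=> x; rewrite -[x]qpi_repr q_addE add0r. Qed.
Fact q_addN : left_inverse (qpi W 0) q_opp q_add.
Proof. by move=> x; rewrite -[x]qpi_repr q_oppE q_addE addNr. Qed.

HB.instance Definition _ :=
  GRing.isZmodule.Build (quotm W) q_addA q_addC q_add0 q_addN.

Fact q_scaleA a b x : q_scale a (q_scale b x) = q_scale (a * b) x.
Proof. by rewrite -[x]qpi_repr !q_scaleE scalerA. Qed.
Fact q_scale1 : left_id 1 q_scale.
Proof. by move=> x; rewrite -[x]qpi_repr q_scaleE scale1r. Qed.
Fact q_scaleDr : right_distributive q_scale +%R.
Proof.
move=> a x y; rewrite -[x]qpi_repr -[y]qpi_repr.
by rewrite [LHS](congr1 _ (q_addE _ _)) !q_scaleE scalerDr -q_addE.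
Qed.
Fact q_scaleDl x : {morph q_scale^~ x : a b / a + b}.
Proof.
by move=> a b; rewrite -[x]qpi_repr /= !q_scaleE scalerDl -q_addE.
Qed.

HB.instance Definition _ :=
  GRing.Zmodule_isLmodule.Build K (quotm W) q_scaleA q_scale1 q_scaleDr q_scaleDl.

Fact qpi_linear : linear (qpi W).
Proof. by move=> k x y; rewrite -q_addE -q_scaleE. Qed.
HB.instance Definition _ :=
  GRing.isLinear.Build K V (quotm W) *:%R (qpi W) qpi_linear.

Lemma qpi0P (v : V) : qpi W v = 0 <-> W v.
Proof. by rewrite -[0](linear0 (qpi W)) qpi_eq subr0. Qed.
End QuotOps.

End SubmodTheory.

Section LinearSubmod.
Variables (K : pzRingType) (U V : lmodType K).

Fact ker_lin (f : {linear U -> V}) k x y :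
  f x = 0 -> f y = 0 -> f (k *: x + y) = 0.
Proof. by move=> fx fy; rewrite linearP fx fy scaler0 addr0. Qed.
Definition sm_ker (f : {linear U -> V}) : submod U :=
  @Submod K U (fun x => f x = 0) (linear0 f) (@ker_lin f).

Fact img_0 (f : {linear U -> V}) (W : submod U) : (f @` W) 0.
Proof. by exists 0; [exact: sm_0|exact: linear0]. Qed.
Fact img_lin (f : {linear U -> V}) (W : submod U) k x y :
  (f @` W) x -> (f @` W) y -> (f @` W) (k *: x + y).
Proof.
move=> [u Wu <-] [v Wv <-]; exists (k *: u + v); first exact: sm_lin.
exact: linearP.
Qed.
Definition sm_img (f : {linear U -> V}) (W : submod U) : submod V :=
  Submod (@img_0 f W) (@img_lin f W).

Fact preim_0 (f : {linear U -> V}) (W : submod V) : (f @^-1` W) 0.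
Proof. by rewrite /preimage /= linear0; exact: sm_0. Qed.
Fact preim_lin (f : {linear U -> V}) (W : submod V) k x y :
  (f @^-1` W) x -> (f @^-1` W) y -> (f @^-1` W) (k *: x + y).
Proof. by rewrite /preimage /= linearP; exact: sm_lin. Qed.
Definition sm_preim (f : {linear U -> V}) (W : submod V) : submod U :=
  Submod (@preim_0 f W) (@preim_lin f W).

End LinearSubmod.

(* [Z / B]; no inclusion is required, so in general this is [Z / (Z `&` B)] *)
Definition subquot (K : pzRingType) (V : lmodType K) (Z B : submod V)
  : lmodType K := quotm (sm_preim (val : {linear subm Z -> V}) B).

Definition projective_mod (K : pzRingType) (V : lmodType K) : Prop :=
  forall (X Y : lmodType K) (p : {linear X -> Y}) (f : {linear V -> Y}),
    (forall y, exists x, p x = y) ->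
    exists h : {linear V -> X}, forall v, p (h v) = f v.

Section Gradings.
Variables (K : pzRingType) (G : zmodType).

Definition is_grading (V : lmodType K) (C : G -> submod V) : Prop :=
  (forall x : V, exists (s : seq G) (c : G -> V),
     [/\ uniq s, (forall g, C g (c g)) & x = \sum_(g <- s) c g]) /\
  (forall (s : seq G) (c : G -> V), uniq s -> (forall g, C g (c g)) ->
     \sum_(g <- s) c g = 0 -> forall g, g \in s -> c g = 0).

Definition homogeneous (V : lmodType K) (C : G -> submod V) (W : submod V) :=
  forall (s : seq G) (c : G -> V), uniq s -> (forall g, C g (c g)) ->
    W (\sum_(g <- s) c g) -> forall g, g \in s -> W (c g).

Definition quot_comp (V : lmodType K) (C : G -> submod V) (W : submod V) (g : G)
  : submod (quotm W) := sm_img (qpi W) (C g).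

Lemma quot_grading (V : lmodType K) (C : G -> submod V) (W : submod V) :
  is_grading C -> homogeneous C W -> is_grading (quot_comp C W).
Proof.
move=> [Csp Cind] hW; split.
- move=> x; have [s [c [us Cc e]]] := Csp (repr x).
  exists s, (fun g => qpi W (c g)); split => //.
  + by move=> g; exists (c g).
  + by rewrite -linear_sum -e; exact: esym (qpi_repr x).
- move=> s c us Cc.
  have /choice[d Hd] : forall g, exists v, C g v /\ qpi W v = c g.
    by move=> g; have [v Cv <-] := Cc g; exists v.
  rewrite (eq_bigr (fun g => qpi W (d g))); last by move=> g _; have [_ ->] := Hd g.
  rewrite -linear_sum => /qpi0P Wd g gs.
  have [_ <-] := Hd g; apply/qpi0P; apply: (hW s d) => // h.
  by have [] := Hd h.
Qed.

Record gmod := GMod {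
  gm_sort :> lmodType K;
  gm_comp : G -> submod gm_sort;
  gm_grading : is_grading gm_comp
}.

End Gradings.

(* [algType] requires [1 != 0]; here the zero algebra is allowed, since a
   quotient algebra may vanish. *)
Record pzalg (K : comPzRingType) := PzAlg {
  pa_lmod : lmodType K;
  pa_one : pa_lmod;
  pa_mul : pa_lmod -> pa_lmod -> pa_lmod;
  pa_mulA : associative pa_mul;
  pa_1mul : left_id pa_one pa_mul;
  pa_mul1 : right_id pa_one pa_mul;
  pa_linl : forall y, linear (pa_mul^~ y);
  pa_linr : forall x, linear (pa_mul x)
}.

Definition pa_sort (K : comPzRingType) (A : pzalg K) : Type := pa_lmod A.
Coercion pa_sort : pzalg >-> Sortclass.

Section PzAlgebraTheory.
Variables (K : comPzRingType) (A : pzalg K).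

HB.instance Definition _ := GRing.Lmodule.on (pa_sort A).

Fact pa_mulDl : left_distributive (@pa_mul K A) +%R.
Proof. by move=> x y z; have := pa_linl z 1 x y; rewrite /= !scale1r. Qed.
Fact pa_mulDr : right_distributive (@pa_mul K A) +%R.
Proof. by move=> x y z; have := pa_linr x 1 y z; rewrite /= !scale1r. Qed.
HB.instance Definition _ := GRing.Zmodule_isPzRing.Build (pa_sort A)
  (@pa_mulA K A) (@pa_1mul K A) (@pa_mul1 K A) pa_mulDl pa_mulDr.

Lemma pa_scaleAl (k : K) (x y : A) : k *: (x * y) = (k *: x) * y.
Proof.
have e : pa_mul 0 y = 0 := mul0r (y : A).
by have := pa_linl y k x 0; rewrite /= e !addr0 => /esym.
Qed.
Lemma pa_scaleAr (k : K) (x y : A) : k *: (x * y) = x * (k *: y).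
Proof.
have e : pa_mul x 0 = 0 := mulr0 (x : A).
by have := pa_linr x k y 0; rewrite /= e !addr0 => /esym.
Qed.
End PzAlgebraTheory.

Section GradedAlgebras.
Variables (K : comPzRingType) (G : zmodType).

Record galg := GAlg {
  ga_sort :> pzalg K;
  ga_comp : G -> submod ga_sort;
  ga_grading : is_grading ga_comp;
  ga_1 : ga_comp 0 1;
  ga_M : forall g h (x y : ga_sort),
    ga_comp g x -> ga_comp h y -> ga_comp (g + h) (x * y)
}.

Definition ga_gmod (F : galg) : gmod K G := GMod (ga_grading F).

(* An ideal of a unital K-algebra is automatically a K-submodule. *)
Record hideal (F : galg) := HIdeal {
  hi_sub :> submod F;
  hi_l : forall a x : F, hi_sub x -> hi_sub (a * x);
  hi_r : forall a x : F, hi_sub x -> hi_sub (x * a);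
  hi_hom : homogeneous (ga_comp F) hi_sub
}.

Record rhideal (F : galg) := RHIdeal {
  rhi_sub :> submod F;
  rhi_r : forall a x : F, rhi_sub x -> rhi_sub (x * a);
  rhi_hom : homogeneous (ga_comp F) rhi_sub
}.

Record lhideal (F : galg) := LHIdeal {
  lhi_sub :> submod F;
  lhi_l : forall a x : F, lhi_sub x -> lhi_sub (a * x);
  lhi_hom : homogeneous (ga_comp F) lhi_sub
}.

Definition sm_mul (F : galg) (U W : submod F) : submod F :=
  span [set z | exists x y, [/\ U x, W y & z = x * y]].

Fixpoint sm_exp (F : galg) (W : submod F) (n : nat) : submod F :=
  if n is m.+1 then sm_mul (sm_exp W m) W else sm_top F.

Section QuotientAlgebra.
Variables (F : galg) (I : hideal F).

Definition qa_mul (x y : quotm I) : quotm I := qpi I (repr x * repr y).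

Fact qa_mulE (u v : F) : qa_mul (qpi I u) (qpi I v) = qpi I (u * v).
Proof.
apply/qpi_eq; set u' := repr _; set v' := repr _.
rewrite -[u' * v'](subrK (u' * v)) -mulrBr -addrA -mulrBl.
by apply: smD; [apply: hi_l|apply: hi_r]; exact: repr_qpi.
Qed.

Fact qa_mulA : associative qa_mul.
Proof.
move=> x y z; rewrite -[x]qpi_repr -[y]qpi_repr -[z]qpi_repr.
by rewrite !qa_mulE mulrA.
Qed.
Fact qa_1mul : left_id (qpi I 1) qa_mul.
Proof. by move=> x; rewrite -[x]qpi_repr qa_mulE mul1r. Qed.
Fact qa_mul1 : right_id (qpi I 1) qa_mul.
Proof. by move=> x; rewrite -[x]qpi_repr qa_mulE mulr1. Qed.
Fact qa_linl y : linear (qa_mul^~ y).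
Proof.
move=> k u v; rewrite -[u]qpi_repr -[v]qpi_repr -[y]qpi_repr /=.
by rewrite -linearP !qa_mulE mulrDl -pa_scaleAl linearP.
Qed.
Fact qa_linr x : linear (qa_mul x).
Proof.
move=> k u v; rewrite -[u]qpi_repr -[v]qpi_repr -[x]qpi_repr /=.
by rewrite -linearP !qa_mulE mulrDr -pa_scaleAr linearP.
Qed.
Definition quotalg : pzalg K := PzAlg qa_mulA qa_1mul qa_mul1 qa_linl qa_linr.

Lemma quotalgM (u v : F) :
  (qpi I u : quotalg) * (qpi I v : quotalg) = qpi I (u * v).
Proof. exact: qa_mulE. Qed.

Definition quotalg_comp : G -> submod quotalg := quot_comp (ga_comp F) I.

Fact quotalg_grading : is_grading quotalg_comp.
Proof. exact: quot_grading (ga_grading F) (@hi_hom F I). Qed.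
Fact quotalg_1 : quotalg_comp 0 1.
Proof. by exists 1 => //; exact: ga_1. Qed.
Fact quotalg_M g h (x y : quotalg) :
  quotalg_comp g x -> quotalg_comp h y -> quotalg_comp (g + h) (x * y).
Proof.
move=> [u Cu <-] [v Cv <-]; exists (u * v); first exact: ga_M.
exact: esym (quotalgM u v).
Qed.

Definition quot_galg : galg :=
  @GAlg quotalg quotalg_comp quotalg_grading quotalg_1 quotalg_M.

Lemma quot_galgM (u v : F) :
  (qpi I u : quot_galg) * (qpi I v : quot_galg) = qpi I (u * v).
Proof. exact: quotalgM. Qed.

End QuotientAlgebra.

Record is_ract (A : galg) (M : gmod K G) (r : M -> A -> M) : Prop := IsRAct {
  ract_linl : forall a, linear (r^~ a);
  ract_linr : forall x, linear (r x);
  ract_1 : forall x, r x 1 = x;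
  ract_M : forall x a b, r x (a * b) = r (r x a) b;
  ract_deg : forall g h x a,
    gm_comp M g x -> ga_comp A h a -> gm_comp M (g + h) (r x a)
}.

Record is_lact (A : galg) (M : gmod K G) (l : A -> M -> M) : Prop := IsLAct {
  lact_linl : forall x, linear (l^~ x);
  lact_linr : forall a, linear (l a);
  lact_1 : forall x, l 1 x = x;
  lact_M : forall a b x, l (a * b) x = l a (l b x);
  lact_deg : forall g h a x,
    ga_comp A g a -> gm_comp M h x -> gm_comp M (g + h) (l a x)
}.

Record rgmod (A : galg) := RGMod {
  rg_mod :> gmod K G;
  ract : rg_mod -> A -> rg_mod;
  ractP : is_ract ract
}.

Record lgmod (A : galg) := LGMod {
  lg_mod :> gmod K G;
  lact : A -> lg_mod -> lg_mod;
  lactP : is_lact lact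
}.

(* [bi_l] and [bi_r] being K-bilinear, both restrict to the same action of K:
   these are the right modules over F^op (x)_K F. *)
Record gbimod (F : galg) := GBimod {
  bi_mod :> gmod K G;
  bi_l : F -> bi_mod -> bi_mod;
  bi_r : bi_mod -> F -> bi_mod;
  bi_lP : is_lact bi_l;
  bi_rP : is_ract bi_r;
  bi_lr : forall a x b, bi_r (bi_l a x) b = bi_l a (bi_r x b)
}.

Record rhom (A : galg) (M N : rgmod A) := RHom {
  rh_fun :> {linear M -> N};
  rh_act : forall x a, rh_fun (ract x a) = ract (rh_fun x) a;
  rh_deg : forall g x, gm_comp M g x -> gm_comp N g (rh_fun x)
}.

Record bihom (F : galg) (M N : gbimod F) := BiHom {
  bh_fun :> {linear M -> N};
  bh_l : forall a x, bh_fun (bi_l a x) = bi_l a (bh_fun x);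
  bh_r : forall x a, bh_fun (bi_r x a) = bi_r (bh_fun x) a;
  bh_deg : forall g x, gm_comp M g x -> gm_comp N g (bh_fun x)
}.

Definition rg_projective (A : galg) (P : rgmod A) : Prop :=
  forall (X Y : rgmod A) (p : rhom X Y) (f : rhom P Y),
    (forall y, exists x, p x = y) ->
    exists h : rhom P X, forall v, p (h v) = f v.

Definition bi_projective (F : galg) (P : gbimod F) : Prop :=
  forall (X Y : gbimod F) (p : bihom X Y) (f : bihom P Y),
    (forall y, exists x, p x = y) ->
    exists h : bihom P X, forall v, p (h v) = f v.

Fact self_lact (F : galg) : @is_lact F (ga_gmod F) *%R.
Proof.
split=> /=.
- by move=> x k a b /=; rewrite mulrDl pa_scaleAl.
- by move=> x k a b /=; rewrite mulrDr pa_scaleAr.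
- exact: mul1r.
- by move=> a b x; rewrite mulrA.
- exact: ga_M.
Qed.
Fact self_ract (F : galg) : @is_ract F (ga_gmod F) *%R.
Proof.
split=> /=.
- by move=> x k a b /=; rewrite mulrDl pa_scaleAl.
- by move=> x k a b /=; rewrite mulrDr pa_scaleAr.
- exact: mulr1.
- by move=> a b x; rewrite mulrA.
- exact: ga_M.
Qed.
Definition self_bimod (F : galg) : gbimod F :=
  GBimod (self_lact F) (self_ract F) (fun a x b => esym (mulrA a x b)).

(* The graded bimodule F has a projective resolution 0 -> P1 -> P0 -> F -> 0. *)
Definition quasi_free (F : galg) : Prop :=
  exists (P1 P0 : gbimod F) (d : bihom P1 P0) (e : bihom P0 (self_bimod F)),
    [/\ bi_projective P1 /\ bi_projective P0,
        injective d,
        (forall x, e x = 0 <-> exists y, d y = x)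
      & (forall a, exists x, e x = a)].

Section QuotientModules.
Variables (F : galg) (I : hideal F).

Section Right.
Variables (J : rhideal F) (IJ : I `<=` J).

Definition qr_gmod : gmod K G :=
  GMod (quot_grading (ga_grading F) (@rhi_hom F J)).

Definition qr_act (x : qr_gmod) (a : quot_galg I) : qr_gmod :=
  qpi J (repr (x : quotm J) * repr (a : quotm I)).

Lemma qr_actE (u a : F) : qr_act (qpi J u) (qpi I a) = qpi J (u * a).
Proof.
apply/qpi_eq; set u' := repr _; set a' := repr _.
rewrite -[u' * a'](subrK (u' * a)) -mulrBr -addrA -mulrBl; apply: smD.
- by apply/IJ/hi_l/repr_qpi.
- by apply/rhi_r/repr_qpi.
Qed.

Fact qr_is_ract : is_ract qr_act.
Proof.
split=> /=.
- move=> a k x y; rewrite -[a]qpi_repr -[x]qpi_repr -[y]qpi_repr /=.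
  by rewrite -linearP !qr_actE mulrDl -pa_scaleAl linearP.
- move=> x k a b; rewrite -[a]qpi_repr -[x]qpi_repr -[b]qpi_repr /=.
  by rewrite -linearP !qr_actE mulrDr -pa_scaleAr linearP.
- by move=> x; rewrite -[x]qpi_repr qr_actE mulr1.
- move=> x a b; rewrite -[a]qpi_repr -[x]qpi_repr -[b]qpi_repr.
  by rewrite quot_galgM (qr_actE (repr x) (repr a)) !qr_actE mulrA.
- move=> g h _ _ [u Cu <-] [a Ca <-]; rewrite qr_actE.
  by exists (u * a) => //; exact: ga_M.
Qed.

Definition quot_rgmod : rgmod (quot_galg I) := RGMod qr_is_ract.
End Right.

Section Left.
Variables (J : lhideal F) (IJ : I `<=` J).

Definition ql_gmod : gmod K G :=
  GMod (quot_grading (ga_grading F) (@lhi_hom F J)).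

Definition ql_act (a : quot_galg I) (x : ql_gmod) : ql_gmod :=
  qpi J (repr (a : quotm I) * repr (x : quotm J)).

Lemma ql_actE (a u : F) : ql_act (qpi I a) (qpi J u) = qpi J (a * u).
Proof.
apply/qpi_eq; set u' := repr _; set a' := repr _.
rewrite -[u' * a'](subrK (u' * u)) -mulrBr -addrA -mulrBl; apply: smD.
- by apply/lhi_l/repr_qpi.
- by apply/IJ/hi_r/repr_qpi.
Qed.

Fact ql_is_lact : is_lact ql_act.
Proof.
split=> /=.
- move=> x k a b; rewrite -[a]qpi_repr -[x]qpi_repr -[b]qpi_repr /=.
  by rewrite -linearP !ql_actE mulrDl -pa_scaleAl linearP.
- move=> a k x y; rewrite -[a]qpi_repr -[x]qpi_repr -[y]qpi_repr /=.
  by rewrite -linearP !ql_actE mulrDr -pa_scaleAr linearP.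
- by move=> x; rewrite -[x]qpi_repr ql_actE mul1r.
- move=> a b x; rewrite -[a]qpi_repr -[x]qpi_repr -[b]qpi_repr.
  by rewrite quot_galgM (ql_actE (repr b) (repr x)) !ql_actE mulrA.
- move=> g h _ _ [a Ca <-] [u Cu <-]; rewrite ql_actE.
  by exists (a * u) => //; exact: ga_M.
Qed.

Definition quot_lgmod : lgmod (quot_galg I) := LGMod ql_is_lact.
End Left.
End QuotientModules.

End GradedAlgebras.

Section FreeModule.
Variables (K : pzRingType) (X : choiceType).

Definition fsupp (f : X -> K^o) : set X := [set x | f x != 0].

Fact fs_0 : finite_set (fsupp 0).
Proof.
by rewrite (_ : fsupp 0 = set0) //; apply/seteqP; split=> // x /eqP; apply.
Qed.
Fact fs_lin (k : K) (f g : X -> K^o) :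
  finite_set (fsupp f) -> finite_set (fsupp g) ->
  finite_set (fsupp (k *: f + g)).
Proof.
move=> ff fg; apply: (@sub_finite_set _ _ (fsupp f `|` fsupp g)).
  move=> x /=; apply: contra_neqP => /not_orP[/negP + /negP].
  by rewrite !negbK => /eqP fx /eqP gx; have -> : (k *: f + g) x = k * f x + g x by []; rewrite fx gx mulr0 addr0.
by rewrite finite_setU.
Qed.

(* the free K-module on X: finitely supported functions *)
Definition freem : lmodType K :=
  subm (@Submod K (X -> K^o) (fun f => finite_set (fsupp f)) fs_0 fs_lin).

Fact fdelta_fs (x : X) : finite_set (fsupp (fun y => (y == x)%:R)).
Proof.
apply: (@sub_finite_set _ _ [set x]); last exact: finite_set1.
by move=> y; rewrite /fsupp /=; case: (y =P x) => // _ /eqP; case.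
Qed.
Definition fdelta (x : X) : freem :=
  exist _ (fun y => (y == x)%:R) (introT (asboolP _) (fdelta_fs x)).

Section Lift.
Variables (T : lmodType K) (b : X -> T).

Definition flift (f : freem) : T :=
  \sum_(x \in [set: X]) (val f x : K) *: b x.

Lemma fliftE (f : freem) (S : {fset X}) : fsupp (val f) `<=` [set` S] ->
  flift f = \sum_(x <- S) (val f x : K) *: b x.
Proof.
move=> fS; apply: fsbigTE => x xS.
suff -> : val f x = 0 by rewrite scale0r.
by apply: contraNeq xS => fx; exact: fS.
Qed.

Fact flift_linear : linear flift.
Proof.
move=> k f g.
have /finite_fsetP[Sf eSf] := submP f; have /finite_fsetP[Sg eSg] := submP g.
pose S := (Sf `|` Sg)%fset.
have sf : fsupp (val f) `<=` [set` S].
  by rewrite [fsupp _]eSf => x /= xS; rewrite inE xS.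
have sg : fsupp (val g) `<=` [set` S].
  by rewrite [fsupp _]eSg => x /= xS; rewrite inE xS orbT.
rewrite (fliftE sf) (fliftE sg) (@fliftE (k *: f + g) S); last first.
  move=> x /= fgx; apply: contrapT => xS; move/eqP: fgx; apply.
  change (k * val f x + val g x = 0).
  have -> : val f x = 0 by apply: contra_notP xS => /eqP; exact: sf.
  have -> : val g x = 0 by apply: contra_notP xS => /eqP; exact: sg.
  by rewrite mulr0 addr0.
rewrite scaler_sumr -big_split /=; apply: eq_bigr => x _.
by rewrite scalerA -scalerDl.
Qed.
HB.instance Definition _ :=
  GRing.isLinear.Build K freem T *:%R flift flift_linear.

Lemma flift_delta x : flift (fdelta x) = b x.
Proof.
rewrite (@fliftE _ [fset x]%fset); last first.
  by move=> y /eqP; rewrite /= inE; case: (y =P x) => // _; case.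
by rewrite big_seq_fset1 /= eqxx scale1r.
Qed.
End Lift.
End FreeModule.

Section QuotientLift.
Variables (K : pzRingType) (V T : lmodType K) (W : submod V).
Variables (f : {linear V -> T}) (Wf : W `<=` sm_ker f).

Definition qlift (x : quotm W) : T := f (repr x).

Lemma qliftE v : qlift (qpi W v) = f v.
Proof. by apply/subr0_eq; rewrite -linearB; apply/Wf/repr_qpi. Qed.

Fact qlift_linear : linear qlift.
Proof.
move=> k x y; rewrite -[x]qpi_repr -[y]qpi_repr -linearP.
by rewrite !qliftE linearP.
Qed.
HB.instance Definition _ :=
  GRing.isLinear.Build K (quotm W) T *:%R qlift qlift_linear.
Definition qlift_lin : {linear quotm W -> T} := qlift.
End QuotientLift.

Section Tensor.
Variables (K : comPzRingType) (G : zmodType) (A : galg K G).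

Record balanced (M : rgmod A) (N : lgmod A) (T : lmodType K) := Balanced {
  bal_fun :> M -> N -> T;
  bal_linl : forall y, linear (bal_fun^~ y);
  bal_linr : forall x, linear (bal_fun x);
  bal_act : forall x a y, bal_fun (ract x a) y = bal_fun x (lact a y)
}.

Section Def.
Variables (M : rgmod A) (N : lgmod A).

Local Notation e x y := (fdelta K ((x, y) : (M * N)%type)).

Inductive tens_rel : freem K (M * N)%type -> Prop :=
| TensRelL k x x' y : tens_rel (e (k *: x + x') y - (k *: e x y + e x' y))
| TensRelR k x y y' : tens_rel (e x (k *: y + y') - (k *: e x y + e x y'))
| TensRelAct x a y : tens_rel (e (ract x a) y - e x (lact a y)).

Definition tens : lmodType K := quotm (span tens_rel).

Definition pure (x : M) (y : N) : tens := qpi (span tens_rel) (e x y).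

Definition tens_comp (g : G) : submod tens :=
  span [set t | exists h i x y,
    [/\ gm_comp M h x, gm_comp N i y, h + i = g & t = pure x y]].

Fact pure_linl y : linear (pure^~ y).
Proof.
move=> k x x'; rewrite /= /pure -linearP; apply/qpi_eq.
exact: (span_sub (TensRelL k x x' y)).
Qed.
Fact pure_linr x : linear (pure x).
Proof.
move=> k y y'; rewrite /= /pure -linearP; apply/qpi_eq.
exact: (span_sub (TensRelR k x y y')).
Qed.
Fact pure_act x a y : pure (ract x a) y = pure x (lact a y).
Proof. by apply/qpi_eq; exact: (span_sub (TensRelAct x a y)). Qed.
Definition pure_balanced : balanced M N tens :=
  Balanced pure_linl pure_linr pure_act.

Section Lift.
Variables (T : lmodType K) (b : balanced M N T).

Let bu (p : M * N) := b p.1 p.2.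

Fact tens_lift_rel : span tens_rel `<=` sm_ker (flift bu).
Proof.
move=> t /(_ (sm_ker (flift bu))); apply=> _ [k x x' y|k x y y'|x a y] /=;
  rewrite (linearB (flift bu)) ?(linearP (flift bu)) /= !flift_delta /bu /=.
- by apply/eqP; rewrite subr_eq0; apply/eqP; exact: bal_linl.
- by apply/eqP; rewrite subr_eq0; apply/eqP; exact: bal_linr.
- by apply/eqP; rewrite subr_eq0; apply/eqP; exact: bal_act.
Qed.
Definition tens_lift : {linear tens -> T} := qlift_lin tens_lift_rel.

Lemma tens_lift_pure x y : tens_lift (pure x y) = b x y.
Proof. by rewrite [LHS](qliftE tens_lift_rel) /= flift_delta. Qed.
End Lift.
End Def.

Section Map.
Variables (M M' : rgmod A) (N : lgmod A) (f : rhom M M').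

Fact tens_map_linl y : linear (fun x => pure (f x) y : tens M' N).
Proof. by move=> k x x'; rewrite linearP; exact: pure_linl. Qed.
Fact tens_map_act x a y : pure (f (ract x a)) y = pure (f x) (lact a y) :> tens M' N.
Proof. by rewrite rh_act pure_act. Qed.

(* f (x) id_N *)
Definition tens_map : {linear tens M N -> tens M' N} :=
  tens_lift (Balanced tens_map_linl (fun x => pure_linr (f x)) tens_map_act).

Lemma tens_map_pure x y : tens_map (pure x y) = pure (f x) y.
Proof. exact: tens_lift_pure. Qed.
End Map.

Record gresolution (S : rgmod A) := GResolution {
  res_mod : nat -> rgmod A;
  res_d : forall n, rhom (res_mod n.+1) (res_mod n);
  res_aug : rhom (res_mod 0) S;
  res_proj : forall n, rg_projective (res_mod n);
  res_surj : forall s, exists x, res_aug x = s;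
  res_exact0 : forall x, res_aug x = 0 <-> exists y, res_d 0 y = x;
  res_exact : forall n x, res_d n x = 0 <-> exists y, res_d n.+1 y = x
}.

(* Degree-g component of the graded module [Z / B], for homogeneous [Z] and [B]
   with [B `<=` Z]. *)
Definition gsubquot (V : lmodType K) (C : G -> submod V) (Z B : submod V)
  (g : G) : lmodType K := subquot (sm_cap Z (C g)) (sm_cap B (C g)).

Section Tor.
Variables (S : rgmod A) (P : gresolution S) (N : lgmod A).

Definition tor_cycles (n : nat) : submod (tens (res_mod P n) N) :=
  match n with
  | 0 => sm_top _
  | m.+1 => sm_ker (tens_map N (res_d P m))
  end.

Definition tor_boundaries (n : nat) : submod (tens (res_mod P n) N) :=
  sm_img (tens_map N (res_d P n)) (sm_top _).

Definition tor (n : nat) : G -> lmodType K :=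
  gsubquot (@tens_comp (res_mod P n) N) (tor_cycles n) (tor_boundaries n).
End Tor.

End Tensor.

Definition graded_iso (K : pzRingType) (G : Type) (U W : G -> lmodType K) : Prop :=
  exists f : forall g, {linear U g -> W g}, forall g, bijective (f g).

Section Numerators.
Variables (K : comPzRingType) (G : zmodType) (F : galg K G).
Variables (I J J' : submod F).

(* For n = 0 the factor I^(n-1) is undefined; the numerator is then F. *)
Definition even_num (n : nat) : submod F :=
  if n is m.+1 then sm_cap (sm_exp I n) (sm_mul (sm_mul J (sm_exp I m)) J')
  else sm_top F.
Definition even_den (n : nat) : submod F :=
  sm_add (sm_mul J (sm_exp I n)) (sm_mul (sm_exp I n) J').
Definition odd_num (n : nat) : submod F :=
  sm_cap (sm_mul J (sm_exp I n)) (sm_mul (sm_exp I n) J').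
Definition odd_den (n : nat) : submod F :=
  sm_add (sm_exp I n.+1) (sm_mul (sm_mul J (sm_exp I n)) J').
End Numerators.

(* Main.v *)
Require Import Defs.
From HB Require Import structures.
From mathcomp Require Import all_boot all_order all_algebra.
From mathcomp Require Import finmap.
From mathcomp Require Import boolp classical_sets functions cardinality.

Set Implicit Arguments.
Unset Strict Implicit.
Unset Printing Implicit Defensive.

Import GRing.Theory.
Local Open Scope classical_set_scope.
Local Open Scope ring_scope.

(** Put [A = F / I] and let [X 0 = F], [X 1 = J], [X (n + 2) = X n I], so that
    [X (2 n) = I ^ n] and [X (2 n + 1) = J I ^ n]. These right ideals decrease,
    and the quotients [X n / X n I], with the maps induced by the inclusions
    [X (n + 1) <= X n], form an exact complex of right [A]-modules ending in
    [F / I -> F / J]: the kernel of the map out of [X (n + 1) / X (n + 1) I] is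
    [X n I / X (n + 1) I], and [X n I] is [X (n + 2)] ([gr_exact]).

    The complex is a projective resolution because [F] is quasi-free. The two
    facts needed, for a homogeneous right ideal [X] such that [F / X] is
    projective over [K], are that [X] is then a projective right [F]-module
    ([quasi_free_rh_projective]) and, as [A] is projective over [K] too, that
    [F / X I] is again projective over [K] ([relproj_mul]); so by induction
    every [X n] is projective over [F], and [X n / X n I] is projective over [A]
    ([piece_projective]). The first fact expresses that [F / X] has projective
    dimension at most one: a bimodule resolution [0 -> P1 -> P0 -> F -> 0] is
    mapped into the bimodules [Hom_K(F / X, N)], which depend exactly on [N].
    The second uses the coinduced modules [Hom_K(A, U)] in the same way.

    Finally, [X / X I] tensored over [A] with [F / J'] is [X / X J']
    ([iota_eq0], [iota_surj]), so Tor is the homology of the complex of the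
    [X n / X n J']: in position [n + 1] the cycles are the intersection of
    [X (n + 1)] with [X n J'], and in position [n] the boundaries are
    [X (n + 1) + X n J'] ([tor_gr_resolution]). The comparison of resolutions
    ([tor_indep]) replaces this resolution by an arbitrary one. *)

(** * Linear maps and submodules *)

Section LinearMaps.
Variables (K : pzRingType) (U V : lmodType K).

Definition lin_of (f : U -> V) (hf : linear f) : {linear U -> V} :=
  HB.pack f (GRing.isLinear.Build K U V *:%R f hf).

Lemma lin_funD (f : U -> V) : linear f -> forall x y, f (x + y) = f x + f y.
Proof. by move=> hf x y; exact: (linearD (lin_of hf)). Qed.

Lemma lin_fun0 (f : U -> V) : linear f -> f 0 = 0.
Proof. by move=> hf; exact: (linear0 (lin_of hf)). Qed.

Lemma lin_funB (f : U -> V) : linear f -> forall x y, f (x - y) = f x - f y.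
Proof. by move=> hf x y; exact: (linearB (lin_of hf)). Qed.

Lemma lin_fun_sum (f : U -> V) : linear f ->
  forall (I : Type) (s : seq I) (c : I -> U),
    f (\sum_(i <- s) c i) = \sum_(i <- s) f (c i).
Proof. by move=> hf I s c; exact: (linear_sum (lin_of hf)). Qed.

End LinearMaps.

Lemma sm_sum (K : pzRingType) (V : lmodType K) (W : submod V) (I : Type)
  (s : seq I) (c : I -> V) : (forall i, W (c i)) -> W (\sum_(i <- s) c i).
Proof. by move=> Wc; elim/big_ind: _ => //; [exact: sm_0|exact: smD]. Qed.

Definition insm (K : pzRingType) (V : lmodType K) (W : submod V) (x : V)
  (Wx : W x) : subm W := exist _ x (introT (asboolP (W x)) Wx).

(** * Homogeneous parts *)

Lemma sum_support (I : eqType) (V : nmodType) (s t : seq I) (f : I -> V) :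
  uniq s -> uniq t -> (forall i, i \notin s -> f i = 0) ->
  (forall i, i \notin t -> f i = 0) -> \sum_(i <- s) f i = \sum_(i <- t) f i.
Proof.
have aux (u v : seq I) : (forall i, i \notin v -> f i = 0) ->
    \sum_(i <- u) f i = \sum_(i <- [seq i <- u | i \in v]) f i.
  move=> fv; rewrite big_filter [LHS](bigID (mem v)) /= [X in _ + X]big1 ?addr0 //.
move=> us ut fs ft; rewrite (aux s t ft) (aux t s fs).
apply/perm_big/uniq_perm; rewrite ?filter_uniq // => i.
by rewrite !mem_filter andbC.
Qed.

Section Grading.
Variables (K : pzRingType) (G : zmodType) (V : lmodType K) (C : G -> submod V).
Hypothesis hC : is_grading C.

Lemma grading_dec x : exists sc : seq G * (G -> V),
  [/\ uniq sc.1, forall g, C g (sc.2 g), forall g, g \notin sc.1 -> sc.2 g = 0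
    & x = \sum_(g <- sc.1) sc.2 g].
Proof.
have [s [c [us Cc ->]]] := hC.1 x.
exists (s, fun g => if g \in s then c g else 0); split=> //=.
- by move=> g; case: ifP => // _; exact: sm_0.
- by move=> g /negPf ->.
- by apply: eq_big_seq => g ->.
Qed.

(** A finite set of degrees outside of which the parts of [x] vanish; it may be
    larger than the support of [x]. *)
Definition hsupp x : seq G := (projT1 (cid (grading_dec x))).1.
Definition hpart g x : V := (projT1 (cid (grading_dec x))).2 g.

Lemma hsupp_uniq x : uniq (hsupp x).
Proof. by rewrite /hsupp; case: cid => sc []. Qed.
Lemma hpart_in g x : C g (hpart g x).
Proof. by rewrite /hpart; case: cid => sc []. Qed.
Lemma hpart_out x g : g \notin hsupp x -> hpart g x = 0.
Proof. by rewrite /hpart /hsupp; case: cid => sc /= [_ _ + _]; exact. Qed.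
Lemma hpart_sum x : x = \sum_(g <- hsupp x) hpart g x.
Proof. by rewrite /hpart /hsupp; case: cid => sc /= []. Qed.

Lemma hpartE x s (c : G -> V) : uniq s -> (forall g, C g (c g)) ->
  (forall g, g \notin s -> c g = 0) -> x = \sum_(g <- s) c g ->
  forall g, hpart g x = c g.
Proof.
move=> us Cc c0 ex g; set t := undup (s ++ hsupp x).
have ut : uniq t by rewrite undup_uniq.
have [gt|] := boolP (g \in t); last first.
  by rewrite mem_undup mem_cat negb_or => /andP[/c0 -> /hpart_out].
apply: subr0_eq; apply: (hC.2 t (fun g => hpart g x - c g)) => //.
  by move=> h; apply: smB => //; exact: hpart_in.
rewrite sumrB; apply/eqP; rewrite subr_eq0; apply/eqP.
transitivity x.
  rewrite [RHS]hpart_sum; apply: sum_support => //; rewrite ?hsupp_uniq //.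
    by move=> h; rewrite mem_undup mem_cat negb_or => /andP[_ /hpart_out].
  by move=> h /hpart_out.
rewrite {1}ex; apply: sum_support => // h.
by rewrite mem_undup mem_cat negb_or => /andP[/c0].
Qed.

Lemma hpart_linear g : linear (hpart g).
Proof.
move=> k x y; pose t := undup (hsupp x ++ hsupp y).
have tx h : h \notin t -> hpart h x = 0.
  by rewrite mem_undup mem_cat negb_or => /andP[/hpart_out].
have ty h : h \notin t -> hpart h y = 0.
  by rewrite mem_undup mem_cat negb_or => /andP[_ /hpart_out].
apply: (@hpartE _ t (fun g => k *: hpart g x + hpart g y)); rewrite ?undup_uniq //.
- by move=> h; apply: sm_lin; exact: hpart_in.
- by move=> h ht; rewrite tx // ty // scaler0 addr0.
- rewrite big_split -scaler_sumr /= {1}[x]hpart_sum {1}[y]hpart_sum.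
  by congr (_ *: _ + _); apply: sum_support;
    rewrite ?hsupp_uniq ?undup_uniq // => h /hpart_out.
Qed.

Lemma hpart_comp g h x : C g x -> hpart h x = if h == g then x else 0.
Proof.
move=> Cx.
apply: (@hpartE _ [:: g] (fun h => if h == g then x else 0)) => // [i|i|].
- by case: eqP => [->|] // _; exact: sm_0.
- by rewrite inE => /negPf ->.
- by rewrite big_seq1 eqxx.
Qed.

Lemma hpart_id g x : C g x -> hpart g x = x.
Proof. by move=> /(hpart_comp g) ->; rewrite eqxx. Qed.

Lemma hpart_idE g x : hpart g x = x <-> C g x.
Proof. by split=> [<-|]; [exact: hpart_in|exact: hpart_id]. Qed.

Lemma grading_ind (W : submod V) :
  (forall g x, C g x -> W x) -> forall x, W x.
Proof.
by move=> CW x; rewrite [x]hpart_sum; apply: sm_sum => g; apply/CW/hpart_in.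
Qed.

Lemma homogeneousP (W : submod V) :
  homogeneous C W <-> forall g x, W x -> W (hpart g x).
Proof.
split=> [hW g x|hW s c us Cc Wx g gs].
  have [gs|/hpart_out -> _] := boolP (g \in hsupp x); last exact: sm_0.
  rewrite {1}[x]hpart_sum => Wx; apply: hW Wx _ gs; first exact: hsupp_uniq.
  by move=> h; exact: hpart_in.
suff -> : c g = hpart g (\sum_(g <- s) c g) by exact: hW.
pose d h := if h \in s then c h else 0.
rewrite (@hpartE _ s d) => //; rewrite /d ?gs //.
- by move=> h; case: ifP => // _; exact: sm_0.
- by move=> h /negPf ->.
- by apply: eq_big_seq => h ->.
Qed.

Lemma homogeneous_top : homogeneous C (sm_top V).
Proof. by []. Qed.

Lemma sub_grading (W : submod V) : homogeneous C W ->
  is_grading (fun g => sm_preim (val : {linear subm W -> V}) (C g)).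
Proof.
move=> /homogeneousP hW; split=> [x|s c us Cc e g gs].
  have Wx g : W (hpart g (val x)) by apply/hW/submP.
  exists (hsupp (val x)), (fun g => insm (Wx g)); split.
  - exact: hsupp_uniq.
  - by move=> g; exact: hpart_in.
  - by apply: val_inj; rewrite {1}[val x]hpart_sum linear_sum.
apply: val_inj; rewrite [RHS](linear0 (val : {linear subm W -> V})).
apply: (hC.2 s (fun g => val (c g))) gs => //.
by rewrite -linear_sum e linear0.
Qed.

Section Glue.
Variables (T : lmodType K) (f : G -> V -> T).
Hypothesis hf : forall g, linear (f g).

(** Linear maps chosen independently in each degree assemble to one linear
    map. *)
Definition glue x : T := \sum_(g <- hsupp x) f g (hpart g x).

Lemma glueE x s : uniq s -> (forall g, g \notin s -> hpart g x = 0) ->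
  glue x = \sum_(g <- s) f g (hpart g x).
Proof.
move=> us xs; apply: sum_support => //; rewrite ?hsupp_uniq // => g.
  by move=> /hpart_out ->; exact: lin_fun0.
by move=> /xs ->; exact: lin_fun0.
Qed.

Lemma glue_linear : linear glue.
Proof.
move=> k x y; pose t := undup (hsupp x ++ hsupp y).
have ut : uniq t by rewrite undup_uniq.
have tx h : h \notin t -> hpart h x = 0.
  by rewrite mem_undup mem_cat negb_or => /andP[/hpart_out].
have ty h : h \notin t -> hpart h y = 0.
  by rewrite mem_undup mem_cat negb_or => /andP[_ /hpart_out].
rewrite (glueE ut tx) (glueE ut ty) (@glueE _ t) //; last first.
  by move=> h ht; rewrite hpart_linear tx // ty // scaler0 addr0.
rewrite scaler_sumr -big_split; apply: eq_bigr => g _ /=.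
by rewrite hpart_linear hf.
Qed.

Lemma glue_comp g x : C g x -> glue x = f g x.
Proof.
move=> Cx; rewrite (@glueE _ [:: g]) // ?big_seq1 ?hpart_id // => h.
by rewrite inE (hpart_comp _ Cx) => /negPf ->.
Qed.
End Glue.

End Grading.

Section DirectSum.
Variables (K : pzRingType) (G : zmodType) (V : lmodType K) (C : G -> submod V).

(** The sum of a family of submodules; when the family is independent it is a
    graded module, even if the ambient module is not. *)
Definition fsum : submod V := Defs.span [set x | exists g, C g x].

Lemma fsum_in g x : C g x -> fsum x.
Proof. by move=> Cx; apply: span_sub; exists g. Qed.

(** The finite sums over duplicate-free lists of degrees are closed under
    linear combinations, hence exhaust the span. *)
Lemma fsum_dec x : fsum x -> exists s (c : G -> V),
  [/\ uniq s, forall g, C g (c g) & x = \sum_(g <- s) c g].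
Proof.
pose D x := exists s (c : G -> V), [/\ uniq s, forall g, C g (c g),
  forall g, g \notin s -> c g = 0 & x = \sum_(g <- s) c g].
have D0 : D 0.
  exists [::], (fun=> 0); split; rewrite ?big_nil //.
  by move=> g; exact: sm_0.
have Dlin k y z : D y -> D z -> D (k *: y + z).
  move=> [s [c [us Cc c0 ->]]] [t [d [ut Cd d0 ->]]].
  have sc h : h \notin undup (s ++ t) -> c h = 0.
    by rewrite mem_undup mem_cat negb_or => /andP[/c0].
  have td h : h \notin undup (s ++ t) -> d h = 0.
    by rewrite mem_undup mem_cat negb_or => /andP[_ /d0].
  exists (undup (s ++ t)), (fun g => k *: c g + d g); split.
  - by rewrite undup_uniq.
  - by move=> g; exact: sm_lin.
  - by move=> g gst; rewrite sc // td // scaler0 addr0.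
  - rewrite big_split -scaler_sumr /=.
    by congr (_ *: _ + _); apply: sum_support; rewrite ?undup_uniq.
move=> /(_ (Submod D0 Dlin)) /= [].
  move=> y [g Cy]; exists [:: g], (fun h => if h == g then y else 0); split=> //.
  - by move=> h; case: eqP => [->|] // _; exact: sm_0.
  - by move=> h; rewrite inE => /negPf ->.
  - by rewrite big_seq1 eqxx.
by move=> s [c [us Cc _ ->]]; exists s, c.
Qed.

Lemma fsum_grading :
  (forall (s : seq G) (c : G -> V), uniq s -> (forall g, C g (c g)) ->
     \sum_(g <- s) c g = 0 -> forall g, g \in s -> c g = 0) ->
  is_grading (fun g => sm_preim (val : {linear subm fsum -> V}) (C g)).
Proof.
move=> indep; split=> [x|s c us Cc e g gs].
  have [s [c [us Cc ex]]] := fsum_dec (submP x).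
  exists s, (fun g => insm (fsum_in (Cc g))); split=> //.
  by apply: val_inj; rewrite [LHS]ex linear_sum.
apply: val_inj; rewrite [RHS](linear0 (val : {linear subm fsum -> V})).
apply: (indep s (fun g => val (c g))) gs => //.
by rewrite -linear_sum e linear0.
Qed.
End DirectSum.

Section Shift.
Variables (K : pzRingType) (G : zmodType) (M : gmod K G) (g : G).

Lemma shift_grading : is_grading (fun h => gm_comp M (h + g)).
Proof.
have inj : injective (fun h : G => h + g) by exact: addIr.
have [Msp Mind] := gm_grading M; split=> [x|s c us Cc e h hs].
  have [s [c [us Cc ->]]] := Msp x.
  exists [seq h - g | h <- s], (fun h => c (h + g)); split=> //.
    by rewrite map_inj_uniq //; exact: addIr.
  by rewrite big_map; apply: eq_bigr => h _; rewrite subrK.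
rewrite -[h](addrK g); apply: (Mind [seq h + g | h <- s] (fun h => c (h - g))).
- by rewrite map_inj_uniq.
- by move=> i; rewrite -{1}[i](subrK g).
- by rewrite big_map -[RHS]e; apply: eq_bigr => i _; rewrite addrK.
- exact: (map_f (fun h => h + g) hs).
Qed.

Definition shift : gmod K G := GMod shift_grading.
End Shift.

(** * Graded modules *)

Section GradedMaps.
Variables (K : pzRingType) (G : zmodType).

Definition graded_map (M N : gmod K G) (f : M -> N) : Prop :=
  forall g x, gm_comp M g x -> gm_comp N g (f x).

Variables (M N : gmod K G) (f : {linear M -> N}).
Hypothesis hf : graded_map f.

Lemma hpart_map g x :
  f (hpart (gm_grading M) g x) = hpart (gm_grading N) g (f x).
Proof.
symmetry; apply: (@hpartE _ _ _ _ _ _ (hsupp (gm_grading M) x)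
  (fun g => f (hpart (gm_grading M) g x))).
- exact: hsupp_uniq.
- by move=> h; apply/hf/hpart_in.
- by move=> h /hpart_out ->; exact: linear0.
- by rewrite -linear_sum -hpart_sum.
Qed.

Lemma surj_comp : (forall y, exists x, f x = y) ->
  forall g y, gm_comp N g y -> exists2 x, gm_comp M g x & f x = y.
Proof.
move=> f_surj g y Ny; have [x ex] := f_surj y.
exists (hpart (gm_grading M) g x); first exact: hpart_in.
by rewrite hpart_map ex hpart_id.
Qed.
End GradedMaps.

Section SubQuotientModules.
Variables (K : comPzRingType) (G : zmodType) (A : galg K G) (M : rgmod A).
Variables (W : submod M).
Hypothesis Whom : homogeneous (gm_comp M) W.
Hypothesis Wact : forall x a, W x -> W (ract x a).

Definition sub_gmod : gmod K G := GMod (sub_grading (gm_grading M) Whom).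

Definition sub_act (x : sub_gmod) (a : A) : sub_gmod :=
  insm (Wact a (submP (x : subm W))).

Fact sub_is_ract : is_ract sub_act.
Proof.
split=> /=.
- by move=> a k x y; apply: val_inj; exact: (ract_linl (ractP M)).
- by move=> x k a b; apply: val_inj; exact: (ract_linr (ractP M)).
- by move=> x; apply: val_inj; exact: (ract_1 (ractP M)).
- by move=> x a b; apply: val_inj; exact: (ract_M (ractP M)).
- by move=> g h x a; exact: (ract_deg (ractP M)).
Qed.
Definition sub_rgmod : rgmod A := RGMod sub_is_ract.

Definition quo_gmod : gmod K G := GMod (quot_grading (gm_grading M) Whom).

Definition quo_act (x : quo_gmod) (a : A) : quo_gmod :=
  qpi W (ract (repr (x : quotm W)) a).

Lemma quo_actE x a : quo_act (qpi W x) a = qpi W (ract x a).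
Proof.
apply/qpi_eq; rewrite -(lin_funB (ract_linl (ractP M) a)).
exact/Wact/repr_qpi.
Qed.

Fact quo_is_ract : is_ract quo_act.
Proof.
have H := ractP M; split=> /=.
- move=> a k x y; rewrite -[x]qpi_repr -[y]qpi_repr -linearP !quo_actE.
  by rewrite (ract_linl H) linearP.
- move=> x k a b; rewrite -[x]qpi_repr !quo_actE.
  by rewrite (ract_linr H) linearP.
- by move=> x; rewrite -[x]qpi_repr quo_actE (ract_1 H).
- by move=> x a b; rewrite -[x]qpi_repr !quo_actE (ract_M H).
- move=> g h _ a [u Cu <-] Ca; rewrite quo_actE.
  by exists (ract u a) => //; exact: (ract_deg H).
Qed.
Definition quo_rgmod : rgmod A := RGMod quo_is_ract.

Definition quo_pi : rhom M quo_rgmod.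
Proof.
refine (@RHom _ _ _ M quo_rgmod (qpi W : {linear M -> quotm W}) _ _).
- by move=> x a; symmetry; exact: quo_actE.
- by move=> g x Cx; exists x.
Defined.
End SubQuotientModules.

Definition self_rgmod (K : comPzRingType) (G : zmodType) (F : galg K G) :
  rgmod F := RGMod (self_ract F).

Definition rh_rgmod (K : comPzRingType) (G : zmodType) (F : galg K G)
    (X : rhideal F) : rgmod F :=
  @sub_rgmod K G F (self_rgmod F) X (@rhi_hom _ _ _ X)
    (fun x a => @rhi_r _ _ _ X a x).

Definition rhq_rgmod (K : comPzRingType) (G : zmodType) (F : galg K G)
    (X : rhideal F) : rgmod F :=
  @quo_rgmod K G F (self_rgmod F) X (@rhi_hom _ _ _ X)
    (fun x a => @rhi_r _ _ _ X a x).

Lemma rhq_actE (K : comPzRingType) (G : zmodType) (F : galg K G)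
    (X : rhideal F) (u a : F) :
  ract (qpi X u : rhq_rgmod X) a = qpi X (u * a).
Proof.
exact: (@quo_actE K G F (self_rgmod F) X (@rhi_hom _ _ _ X)
  (fun x a => @rhi_r _ _ _ X a x)).
Qed.

(** * Graded Hom over the base ring *)

Section Ghom.
Variables (K : comPzRingType) (G : zmodType) (F : galg K G).
Variables (X : submod F) (N : gmod K G).

Definition hdeg_set (g : G) (f : F -> N) : Prop :=
  [/\ linear f, forall x, X x -> f x = 0
    & forall h x, ga_comp F h x -> gm_comp N (h + g) (f x)].

Fact hdeg_0 g : hdeg_set g 0.
Proof.
by split=> [k x y|//|h x _]; [rewrite scaler0 addr0|exact: sm_0].
Qed.

Fact hdeg_lin g (k : K) (f1 f2 : F -> N) :
  hdeg_set g f1 -> hdeg_set g f2 -> hdeg_set g (k *: f1 + f2).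
Proof.
move=> [l1 X1 d1] [l2 X2 d2]; split.
- by move=> c x y; rewrite !fctE l1 l2 !scalerDr !scalerA mulrC addrACA.
- by move=> x Xx; rewrite !fctE X1 // X2 // scaler0 addr0.
- by move=> h x Cx; apply: sm_lin; [exact: d1|exact: d2].
Qed.
Definition hdeg g : submod (F -> N) := Submod (hdeg_0 g) (@hdeg_lin g).

Definition hkill_set (f : F -> N) : Prop :=
  linear f /\ forall x, X x -> f x = 0.
Fact hkill_0 : hkill_set 0.
Proof. by have [? ?] := hdeg_0 0. Qed.
Fact hkill_lin (k : K) (f1 f2 : F -> N) :
  hkill_set f1 -> hkill_set f2 -> hkill_set (k *: f1 + f2).
Proof.
move=> [l1 X1] [l2 X2]; split.
- by move=> c x y; rewrite !fctE l1 l2 !scalerDr !scalerA mulrC addrACA.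
- by move=> x Xx; rewrite !fctE X1 // X2 // scaler0 addr0.
Qed.
Definition hkill : submod (F -> N) := Submod hkill_0 hkill_lin.

Lemma hdeg_indep (s : seq G) (c : G -> F -> N) : uniq s ->
  (forall g, hdeg g (c g)) -> \sum_(g <- s) c g = 0 ->
  forall g, g \in s -> c g = 0.
Proof.
move=> us hc e g gs.
have [lg _ _] := hc g; apply/funext => x.
apply: (@grading_ind _ _ _ _ (ga_grading F) (sm_ker (lin_of lg))) => h y Cy /=.
have inj : injective (fun i : G => h + i) by exact: addrI.
suff : c (h + g - h) y = 0 by rewrite [h + g]addrC addrK.
apply: ((gm_grading N).2 [seq h + i | i <- s] (fun i => c (i - h) y)).
- by rewrite map_inj_uniq.
- by move=> i; have [_ _] := hc (i - h); move/(_ h y Cy); rewrite addrC subrK.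
- rewrite big_map (eq_bigr (fun i => c i y)) => [|i _]; last first.
    by rewrite addrC addKr.
  by rewrite -[RHS]/((0 : F -> N) y) -e fct_sumE.
- exact: (map_f (fun i => h + i) gs).
Qed.

(** The internal Hom of graded [K]-modules from [F / X] to [N], realised by maps
    out of [F] that vanish on [X]. Only finite sums of homogeneous maps are
    taken, since all linear maps together need not form a graded module. *)
Definition ghom : gmod K G := GMod (fsum_grading hdeg_indep).

Definition hval (f : ghom) : F -> N := val (f : subm (fsum hdeg)).

Lemma hval_inj (f1 f2 : ghom) : (forall m, hval f1 m = hval f2 m) -> f1 = f2.
Proof. by move=> e; apply: val_inj; exact/funext. Qed.

Lemma hval_lin (k : K) (f1 f2 : ghom) m :
  hval (k *: f1 + f2) m = k *: hval f1 m + hval f2 m.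
Proof. by []. Qed.

Lemma hval_fsum (f : ghom) : fsum hdeg (hval f).
Proof. exact: submP (f : subm (fsum hdeg)). Qed.

Lemma ghom_kill (f : ghom) : hkill (hval f).
Proof. by apply: (hval_fsum f) => f' [g [l k _]]; split. Qed.

Lemma ghom_lin (f : ghom) : linear (hval f).
Proof. exact: (ghom_kill f).1. Qed.

Lemma ghom_X (f : ghom) x : X x -> hval f x = 0.
Proof. exact: (ghom_kill f).2. Qed.

(** Graded maps into [ghom] are given by pairings. *)
Section Curry.
Variables (P : gmod K G) (b : P -> F -> N).
Hypothesis b_linl : forall m, linear (b^~ m).
Hypothesis b_linr : forall x, linear (b x).
Hypothesis b_X : forall x m, X m -> b x m = 0.
Hypothesis b_deg : forall g h x m,
  gm_comp P g x -> ga_comp F h m -> gm_comp N (h + g) (b x m).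

Fact curry_hdeg g x : gm_comp P g x -> hdeg g (b x).
Proof. by move=> Px; split=> // [m Xm|h m Cm]; [exact: b_X|exact: b_deg]. Qed.

Fact curry_lin0 : linear (b : P -> (F -> N)).
Proof. by move=> k x y; apply/funext => m; exact: b_linl. Qed.

Fact curry_fsum x : fsum hdeg (b x).
Proof.
apply: (@grading_ind _ _ _ _ (gm_grading P)
  (sm_preim (lin_of curry_lin0) (fsum hdeg))) => g y Py.
exact/fsum_in/curry_hdeg/Py.
Qed.

Definition curry_fun (x : P) : ghom := insm (curry_fsum x).
Fact curry_linear : linear curry_fun.
Proof. by move=> k x y; apply: hval_inj => m; exact: b_linl. Qed.
Definition curry : {linear P -> ghom} := lin_of curry_linear.

Lemma curry_deg : graded_map curry.
Proof. by move=> g x Px; exact: curry_hdeg. Qed.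
End Curry.
End Ghom.

(** * Relative projectivity over the base ring *)

(** Projectivity of [F / X] as a graded [K]-module. Maps out of the quotient are
    written as maps out of [F] that vanish on [X], so that right ideals can be
    compared without passing between their quotients. *)
Definition relproj (K : comPzRingType) (G : zmodType) (F : galg K G)
    (X : submod F) : Prop :=
  forall (U V : gmod K G) (p : {linear U -> V}) (f : {linear F -> V}),
    graded_map p -> (forall y, exists x, p x = y) ->
    @graded_map _ _ (ga_gmod F) _ f -> (forall x, X x -> f x = 0) ->
    exists h : {linear F -> U},
      [/\ @graded_map _ _ (ga_gmod F) _ h, forall x, X x -> h x = 0
        & forall x, p (h x) = f x].

Section RelProj.
Variables (K : comPzRingType) (G : zmodType) (F : galg K G).

Lemma relproj_top : relproj (sm_top F).
Proof.
move=> U V p f _ _ _ f0.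
have zl : linear (fun _ : F => 0 : U) by move=> k x y; rewrite scaler0 addr0.
exists (lin_of zl); split=> //=; first by move=> g x _; exact: sm_0.
by move=> x; rewrite f0 // linear0.
Qed.

(** An ungraded lift becomes graded when each homogeneous element [x] of degree
    [g] is sent to the part of degree [g] of its image; this is still a lift
    because [p] preserves degrees. *)
Lemma projective_relproj (X : submod F) : homogeneous (ga_comp F) X ->
  projective_mod (quotm X) -> relproj X.
Proof.
move=> /(homogeneousP (ga_grading F)) hX prX U V p f pd ps fd fX.
have fX' : X `<=` sm_ker f by move=> x; exact: fX.
have [k hk] := prX U V p (qlift_lin fX') ps.
pose c g (x : F) : U := hpart (gm_grading U) g (k (qpi X x)).
have cl g : linear (c g).
  by move=> a x y; rewrite /c !linearP hpart_linear.
exists (lin_of (glue_linear (ga_grading F) cl)); split=> /=.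
- by move=> g x Fx; rewrite (glue_comp _ cl Fx); exact: hpart_in.
- move=> x Xx; rewrite /glue big1_seq // => g _.
  have /qpi0P e : X (hpart (ga_grading F) g x) by exact: hX.
  by rewrite /c e linear0 (lin_fun0 (hpart_linear _ _)).
- move=> x; rewrite /glue linear_sum [in RHS](hpart_sum (ga_grading F) x).
  rewrite linear_sum; apply: eq_bigr => g _.
  rewrite /c (hpart_map pd) hk [qlift_lin _ _](qliftE fX').
  by apply/hpart_id/fd/hpart_in.
Qed.

(** A map of degree [g] is a map of degree [0] into a shifted module. *)
Lemma relproj_hdeg (X : submod F) (U V : gmod K G) (p : {linear U -> V}) :
  relproj X -> graded_map p -> (forall y, exists x, p x = y) ->
  forall g f, hdeg X V g f -> exists2 h, hdeg X U g h & forall x, p (h x) = f x.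
Proof.
move=> rX pd ps g f [fl fX fd].
have pd' : @graded_map _ _ (shift U g) (shift V g) p by move=> h x; exact: pd.
have [h [hd hX hp]] := rX (shift U g) (shift V g) p (lin_of fl) pd' ps fd fX.
by exists (h : F -> U) => //; split=> //; exact: linearP.
Qed.

(** Graded Hom out of [F / X] is exact when [F / X] is [K]-projective: each of
    the finitely many homogeneous summands lifts. *)
Lemma ghom_lift (X : submod F) (U V : gmod K G) (p : {linear U -> V}) :
  relproj X -> graded_map p -> (forall y, exists x, p x = y) ->
  forall f : ghom X V, exists h : ghom X U, forall x, p (hval h x) = hval f x.
Proof.
move=> rX pd ps f.
have [s [c [us hc ef]]] := fsum_dec (hval_fsum f).
have /choice[d hd] g : exists d, hdeg X U g d /\ forall x, p (d x) = c g x.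
  by have [d ? ?] := relproj_hdeg rX pd ps (hc g); exists d.
have Hs : fsum (hdeg X U) (\sum_(g <- s) d g).
  by apply: sm_sum => g; apply: fsum_in; exact: (hd g).1.
exists (insm Hs) => x.
rewrite -[hval _ x]/((\sum_(g <- s) d g) x) [hval f]ef !fct_sumE linear_sum.
by apply: eq_bigr => g _; exact: (hd g).2.
Qed.
End RelProj.

(** * Projectivity of ideals in a quasi-free algebra *)

(** The actions of [F] on [ghom] below are operations of degree zero on linear
    maps; finite sums of homogeneous maps are preserved by all of [F] as soon as
    homogeneous elements preserve homogeneity. *)
Lemma fsum_op (K : comPzRingType) (G : zmodType) (F : galg K G) (X : submod F)
    (M N : gmod K G) (T : F -> (F -> M) -> (F -> N)) :
  (forall a, linear (T a)) -> (forall f, hkill X M f -> linear (T^~ f)) ->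
  (forall g h a f, ga_comp F h a -> hdeg X M g f -> hdeg X N (g + h) (T a f)) ->
  forall a f, fsum (hdeg X M) f -> fsum (hdeg X N) (T a f).
Proof.
move=> Tl Ta Td a f ff.
have kf : hkill X M f := ghom_kill (insm ff).
apply: (@grading_ind _ _ _ _ (ga_grading F)
  (sm_preim (lin_of (Ta f kf)) (fsum (hdeg X N)))) => h b Cb /=.
apply: (ff (sm_preim (lin_of (Tl b)) (fsum (hdeg X N)))) => f' [g Df'].
exact: (fsum_in (Td g h b f' Cb Df')).
Qed.

(** The bimodule [Hom_K(F / X, N)], with [(a f b) m = f (m a) b]. *)
Section HomBimodule.
Variables (K : comPzRingType) (G : zmodType) (F : galg K G).
Variables (X : rhideal F) (N : rgmod F).
Implicit Types (f : ghom X N) (a b : F).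

Fact hom_l_hdeg g h c (u : F -> N) : ga_comp F g c -> hdeg X N h u ->
  hdeg X N (g + h) (fun m => u (m * c)).
Proof.
move=> Cc [l1 X1 d1]; split.
- by move=> k x y; rewrite mulrDl -pa_scaleAl l1.
- by move=> x Xx; apply/X1/rhi_r.
- by move=> k x Cx; rewrite addrA; exact/d1/ga_M.
Qed.

Fact hom_r_hdeg g h c (u : F -> N) : hdeg X N g u -> ga_comp F h c ->
  hdeg X N (g + h) (fun m => ract (u m) c).
Proof.
have H := ractP N; move=> [l1 X1 d1] Cc; split.
- by move=> k x y; rewrite l1 (ract_linl H).
- by move=> x Xx; rewrite X1 // (lin_fun0 (ract_linl H c)).
- by move=> k x Cx; rewrite addrA; apply: (ract_deg H) => //; exact: d1.
Qed.

Fact hom_l_fsum a f : fsum (hdeg X N) (fun m => hval f (m * a)).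
Proof.
apply: (@fsum_op _ _ F X N N (fun a u m => u (m * a)) _ _ _ a
  (hval f) (hval_fsum f)).
- by move=> c k f1 f2; apply/funext.
- move=> f1 [l1 _] k c1 c2; apply/funext => m.
  by rewrite mulrDr -pa_scaleAr l1.
- by move=> g h c f1 Cc D; rewrite [g + h]addrC; exact: hom_l_hdeg.
Qed.
Definition hom_l a f : ghom X N := insm (hom_l_fsum a f).

Lemma hom_lE a f m : hval (hom_l a f) m = hval f (m * a).
Proof. by []. Qed.

Fact hom_r_fsum f b : fsum (hdeg X N) (fun m => ract (hval f m) b).
Proof.
have H := ractP N.
apply: (@fsum_op _ _ F X N N (fun a u m => ract (u m) a) _ _ _ b
  (hval f) (hval_fsum f)).
- by move=> c k f1 f2; apply/funext => m; exact: (ract_linl H).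
- by move=> f1 _ k c1 c2; apply/funext => m; exact: (ract_linr H).
- by move=> g h c f1 Cc D; exact: hom_r_hdeg.
Qed.
Definition hom_r f b : ghom X N := insm (hom_r_fsum f b).

Fact hom_l_lact : is_lact hom_l.
Proof.
split=> /=.
- move=> f k a b; apply: hval_inj => m.
  by rewrite hval_lin !hom_lE mulrDr -pa_scaleAr (ghom_lin f).
- by move=> a k f1 f2; apply: hval_inj.
- by move=> f; apply: hval_inj => m; rewrite hom_lE mulr1.
- by move=> a b f; apply: hval_inj => m; rewrite !hom_lE mulrA.
- by move=> g h a f Ca D; exact: (hom_l_hdeg Ca D).
Qed.

Fact hom_r_ract : is_ract hom_r.
Proof.
have H := ractP N; split=> /=.
- by move=> a k f1 f2; apply: hval_inj => m; exact: (ract_linl H).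
- by move=> f k a b; apply: hval_inj => m; exact: (ract_linr H).
- by move=> f; apply: hval_inj => m; exact: (ract_1 H).
- by move=> f a b; apply: hval_inj => m; exact: (ract_M H).
- by move=> g h f a D Ca; exact: (hom_r_hdeg D Ca).
Qed.

Fact hom_lr a f b : hom_r (hom_l a f) b = hom_l a (hom_r f b).
Proof. by apply: hval_inj. Qed.

Definition hom_bimod : gbimod F := GBimod hom_l_lact hom_r_ract hom_lr.

Section Curry.
Variables (P : gbimod F) (b : P -> F -> N).
Hypothesis b_linl : forall m, linear (b^~ m).
Hypothesis b_linr : forall x, linear (b x).
Hypothesis b_X : forall x m, X m -> b x m = 0.
Hypothesis b_deg : forall g h x m,
  gm_comp P g x -> ga_comp F h m -> gm_comp N (h + g) (b x m).
Hypothesis b_l : forall a x m, b (bi_l a x) m = b x (m * a).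
Hypothesis b_r : forall a x m, b (bi_r x a) m = ract (b x m) a.

Definition curry_bihom : bihom P hom_bimod.
Proof.
refine (@BiHom _ _ _ P hom_bimod (curry b_linl b_linr b_X b_deg) _ _ _).
- by move=> a x; apply: hval_inj => m; exact: b_l.
- by move=> x a; apply: hval_inj => m; exact: b_r.
- exact: curry_deg.
Defined.
End Curry.
End HomBimodule.

Lemma bihom_hdeg (K : comPzRingType) (G : zmodType) (F : galg K G)
    (X : rhideal F) (N : rgmod F) (P : gbimod F)
    (B : bihom P (hom_bimod X N)) g x :
  gm_comp P g x -> hdeg X N g (hval (B x)).
Proof. exact: (@bh_deg _ _ _ _ _ B g x). Qed.

Section HomMap.
Variables (K : comPzRingType) (G : zmodType) (F : galg K G).
Variables (X : rhideal F) (U V : rgmod F) (p : rhom U V).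

Definition hom_map : bihom (hom_bimod X U) (hom_bimod X V).
Proof.
apply: (@curry_bihom _ _ F X V (hom_bimod X U) (fun f m => p (hval f m))).
- by move=> m k f1 f2; exact: linearP.
- by move=> f k m1 m2; rewrite (ghom_lin f) linearP.
- by move=> f m Xm; rewrite (ghom_X f Xm); exact: linear0.
- by move=> g h f m [_ _ df] Cm; apply: rh_deg; exact: df.
- by [].
- by move=> a f m; exact: rh_act.
Defined.

Lemma hom_mapE f m : hval (hom_map f) m = p (hval f m).
Proof. by []. Qed.

Lemma hom_map_surj : relproj X -> (forall y, exists x, p x = y) ->
  forall f, exists h, hom_map h = f.
Proof.
move=> rX ps f; have [h hf] := ghom_lift rX (@rh_deg _ _ _ _ _ p) ps f.
by exists h; apply: hval_inj => m; exact: hf.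
Qed.
End HomMap.

Section QuasiFree.
Variables (K : comPzRingType) (G : zmodType) (F : galg K G).

(** The graded form of the vanishing of [Ext^2_F (F / X, -)], made explicit. Let
    [0 -> P1 -> P0 -> F -> 0] be the resolution with maps [d] and [e], let [x0]
    be an element of [P0] over [1], and for [a] in [F] let [Y a] be the element
    of [P1] with [d (Y a) = x0 a - a x0]; this is a derivation. For a bimodule
    map [Psi] from [P1] to [Hom_K(F / X, U)], the map [j |-> Psi (Y j) 1] is
    right [F]-linear on [X]: the second term of the Leibniz rule for [Y (j b)]
    contributes the value of [Psi (Y b)] at [j], which is zero. The bimodule map
    [Psi] is chosen so that this lifts [j |-> f (u j)] for some [u] with [1 - u]
    in [X]; the rest of [f] is [j |-> f (1 - u) j], which lifts as soon as
    [f (1 - u)] does. *)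
Theorem quasi_free_rh_projective (X : rhideal F) :
  quasi_free F -> relproj X -> rg_projective (rh_rgmod X).
Proof.
move=> [P1 [P0 [d [e [[prP1 prP0] inj_d ex_d sur_e]]]]] rX U V p f p_surj.
have [x0 x0_0 ex0] : exists2 x0, gm_comp P0 0 x0 & e x0 = 1.
  by apply: (surj_comp (@bh_deg _ _ _ _ _ e) sur_e); exact: ga_1.
(* [Phi] lifts the map sending [x] to right multiplication by [e x], from
   values in [F / X] to values in [F]. *)
pose q := @hom_map _ _ _ X _ (rhq_rgmod X) (@quo_pi _ _ _ (self_rgmod F) X _ _).
have q_surj : forall y, exists x, q x = y.
  by apply: hom_map_surj rX _ => y; exists (repr y); exact: qpi_repr.
have [Phi hPhi] : exists Phi : bihom P0 (hom_bimod X (self_rgmod F)),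
    forall x m, X (hval (Phi x) m - m * e x).
  pose b0 (x : P0) (m : F) : rhq_rgmod X := qpi X (m * e x).
  have [B hB] : exists B : bihom P0 (hom_bimod X (rhq_rgmod X)),
      forall x m, hval (B x) m = b0 x m.
    unshelve eexists; first apply: (@curry_bihom _ _ F X (rhq_rgmod X) P0 b0).
    - by move=> m k x y; rewrite /b0 linearP mulrDr -pa_scaleAr linearP.
    - by move=> x k m1 m2; rewrite /b0 mulrDl -pa_scaleAl linearP.
    - by move=> x m Xm; apply/qpi0P; exact: rhi_r.
    - move=> g h x m Cx Cm; exists (m * e x) => //; apply: ga_M => //.
      exact: (@bh_deg _ _ _ _ _ e).
    - by move=> a x m; rewrite /b0 bh_l -[bi_l _ _]/(a * e x) mulrA.
    - by move=> a x m; rewrite /b0 bh_r -[bi_r _ _]/(e x * a) mulrA rhq_actE.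
    - by [].
  have [Phi hPhi] := prP0 _ _ q B q_surj.
  exists Phi => x m; apply/qpi_eq.
  by rewrite -[RHS]hB -hPhi.
(* On the image of [P1] the values of [Phi] lie in [X], so [f] applies to them. *)
have Phi_d y m : X (hval (Phi (d y)) m).
  have := hPhi (d y) m; have -> : e (d y) = 0 by apply/ex_d; exists y.
  by rewrite mulr0 subr0.
have [Om hOm] : exists Om : bihom P1 (hom_bimod X V),
    forall y m, hval (Om y) m = f (insm (Phi_d y m)).
  unshelve eexists.
    apply: (@curry_bihom _ _ F X V P1 (fun y m => f (insm (Phi_d y m)))).
  - move=> m k x y; rewrite -linearP; congr (f _); apply: val_inj.
    by rewrite /= !linearP.
  - move=> y k m1 m2; rewrite -linearP; congr (f _); apply: val_inj.
    exact: (ghom_lin (Phi (d y))).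
  - move=> y m Xm; rewrite -[RHS](linear0 f); congr (f _); apply: val_inj.
    exact: (ghom_X (Phi (d y)) Xm).
  - move=> g h y m Cy Cm; apply: rh_deg.
    have [_ _] : hdeg X (self_rgmod F) g (hval (Phi (d y))).
      by apply: bihom_hdeg; apply: bh_deg.
    by apply.
  - move=> a y m; congr (f _); apply: val_inj => /=.
    by rewrite !bh_l.
  - move=> a y m; rewrite -rh_act; congr (f _); apply: val_inj => /=.
    by rewrite !bh_r.
  - by [].
have [Psi hPsi] := prP1 _ _ (hom_map X p) Om (hom_map_surj rX p_surj).
have pPsi y m : p (hval (Psi y) m) = f (insm (Phi_d y m)).
  by rewrite -hom_mapE hPsi hOm.
have /choice[Y dY] a : exists y, d y = bi_r x0 a - bi_l a x0.
  apply/ex_d; rewrite linearB bh_l bh_r ex0.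
  by rewrite -[LHS]/(1 * a - a * 1 : F) mul1r mulr1 subrr.
have Y_lin : linear Y.
  move=> k a b; apply: inj_d; rewrite linearP !dY.
  rewrite (ract_linr (bi_rP P0)) (lact_linl (bi_lP P0)).
  by rewrite scalerBr opprD addrACA.
have Y_M a b : Y (a * b) = bi_r (Y a) b + bi_l a (Y b).
  apply: inj_d; rewrite linearD bh_l bh_r !dY.
  rewrite (ract_M (bi_rP P0)) (lact_M (bi_lP P0)).
  rewrite (lin_funB (ract_linl (bi_rP P0) b)) (lin_funB (lact_linr (bi_lP P0) a)).
  by rewrite bi_lr addrA subrK.
have Y_deg g a : ga_comp F g a -> gm_comp P1 g (Y a).
  move=> Ca; apply/(hpart_idE (gm_grading P1))/inj_d.
  rewrite (hpart_map (@bh_deg _ _ _ _ _ d)) hpart_id // dY; apply: smB.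
    by rewrite -[g]add0r; apply: (ract_deg (bi_rP P0)).
  by rewrite -[g]addr0; apply: (lact_deg (bi_lP P0)).
(* The element [u] is the value of [Phi x0] at [1]. *)
have X1 : X (1 - hval (Phi x0) 1).
  by rewrite -opprB; apply: smN; have := hPhi x0 1; rewrite ex0 mulr1.
have [x1 x1_0 px1] : exists2 x1, gm_comp U 0 x1 & p x1 = f (insm X1).
  apply: (surj_comp (@rh_deg _ _ _ _ _ p) p_surj); apply: rh_deg.
  apply: smB; first exact: ga_1.
  have [_ _] : hdeg X (self_rgmod F) 0 (hval (Phi x0)) by apply: bihom_hdeg.
  by move=> /(_ 0 1 (ga_1 F)); rewrite addr0.
pose h (j : rh_rgmod X) : U :=
  hval (Psi (Y (val (j : subm X)))) 1 + ract x1 (val (j : subm X)).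
have h_lin : linear h.
  move=> k i j; rewrite /h linearP Y_lin linearP hval_lin.
  by rewrite (ract_linr (ractP U)) scalerDr addrACA.
unshelve eexists.
  refine (@RHom _ _ _ _ _ (lin_of h_lin) _ _).
  - move=> j b; rewrite /= /h -[val _]/(val j * b) Y_M linearD bh_l bh_r.
    rewrite -[hval _ _]/(ract (hval (Psi (Y (val j))) 1) b +
      hval (Psi (Y b)) (1 * val j)).
    rewrite mul1r (ghom_X _ (submP (j : subm X))) addr0 (ract_M (ractP U)).
    by rewrite (lin_funD (ract_linl (ractP U) b)).
  - move=> g j Cj; apply: smD.
      have [_ _] : hdeg X U g (hval (Psi (Y (val (j : subm X))))).
        by apply/bihom_hdeg/Y_deg.
      by move=> /(_ 0 1 (ga_1 F)); rewrite add0r.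
    by rewrite -[g]add0r; apply: (ract_deg (ractP U)).
move=> j; rewrite /= /h linearD pPsi rh_act px1 -rh_act -linearD; congr (f _).
apply: val_inj; set u := hval (Phi x0) 1.
rewrite -[LHS]/(hval (Phi (d (Y (val j)))) 1 + (1 - u) * val j).
rewrite dY linearB bh_l bh_r -[hval _ _]/(u * val j - hval (Phi x0) (1 * val j)).
rewrite mul1r (ghom_X _ (submP (j : subm X))) subr0.
by rewrite -mulrDl addrC subrK mul1r.
Qed.

End QuasiFree.

(** * Products of ideals *)

Section Products.
Variables (K : comPzRingType) (G : zmodType) (F : galg K G).
Implicit Types U W : submod F.

Lemma sm_mul_in U W x y : U x -> W y -> sm_mul U W (x * y).
Proof. by move=> Ux Wy; apply: span_sub; exists x, y. Qed.

Lemma sm_mul_ind U W (T : submod F) :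
  (forall x y, U x -> W y -> T (x * y)) -> forall z, sm_mul U W z -> T z.
Proof. by move=> UWT z; apply=> _ [x [y [Ux Wy ->]]]; exact: UWT. Qed.

Lemma sm_mul_ind_lin (V : lmodType K) U W (T : submod V) (f : F -> V) :
  linear f -> (forall x y, U x -> W y -> T (f (x * y))) ->
  forall z, sm_mul U W z -> T (f z).
Proof. by move=> fl H; exact: (@sm_mul_ind _ _ (sm_preim (lin_of fl) T)). Qed.

Lemma sm_mulS U U' W W' : U `<=` U' -> W `<=` W' ->
  sm_mul U W `<=` sm_mul U' W'.
Proof.
move=> UU' WW'; apply: sm_mul_ind => x y Ux Wy.
by apply: sm_mul_in; [exact: UU'|exact: WW'].
Qed.

Lemma mul_linl (a : F) : linear (fun x : F => x * a).
Proof. by move=> k x y; rewrite mulrDl pa_scaleAl. Qed.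
Lemma mul_linr (a : F) : linear (fun x : F => a * x).
Proof. by move=> k x y; rewrite mulrDr pa_scaleAr. Qed.

Lemma sm_mulA U W T z :
  sm_mul U (sm_mul W T) z <-> sm_mul (sm_mul U W) T z.
Proof.
split; move: z; apply: sm_mul_ind => x y.
  move=> Ux; move: y.
  apply: (sm_mul_ind_lin (mul_linr x)) => a b Wa Tb.
  by rewrite mulrA; apply: sm_mul_in => //; exact: sm_mul_in.
move=> + Ty; move: x.
apply: (sm_mul_ind_lin (mul_linl y)) => a b Ua Wb.
by rewrite -mulrA; apply: sm_mul_in => //; exact: sm_mul_in.
Qed.

Lemma homogeneous_mul U W : homogeneous (ga_comp F) U ->
  homogeneous (ga_comp F) W -> homogeneous (ga_comp F) (sm_mul U W).
Proof.
move=> /(homogeneousP (ga_grading F)) hU /(homogeneousP (ga_grading F)) hW.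
apply/(homogeneousP (ga_grading F)) => g.
apply: (sm_mul_ind_lin (hpart_linear (ga_grading F) g)) => x y Ux Wy.
rewrite (hpart_sum (ga_grading F) x) (hpart_sum (ga_grading F) y).
rewrite mulr_suml (lin_fun_sum (hpart_linear _ _)); apply: sm_sum => h.
rewrite mulr_sumr (lin_fun_sum (hpart_linear _ _)); apply: sm_sum => k.
rewrite (hpart_comp (ga_grading F) (g := h + k)); last first.
  by apply: ga_M; exact: hpart_in.
case: ifP => _; last exact: sm_0.
by apply: sm_mul_in; [exact: hU|exact: hW].
Qed.

Fact rh_mul_r (X : submod F) (I : hideal F) (a x : F) :
  sm_mul X I x -> sm_mul X I (x * a).
Proof.
move: x; apply: (sm_mul_ind_lin (mul_linl a)) => x y Xx Iy.
by rewrite -mulrA; apply: sm_mul_in => //; exact: hi_r.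
Qed.
Definition rh_mul (X : rhideal F) (I : hideal F) : rhideal F :=
  RHIdeal (@rh_mul_r X I) (homogeneous_mul (@rhi_hom _ _ _ X) (@hi_hom _ _ _ I)).

Definition rh_top : rhideal F :=
  @RHIdeal _ _ F (sm_top F) (fun _ _ _ => Logic.I) (@homogeneous_top _ _ _ _).

Lemma rh_mul_sub (X : rhideal F) (W : submod F) : sm_mul X W `<=` X.
Proof. by apply: sm_mul_ind => x y Xx _; exact: rhi_r. Qed.

End Products.

Section HomModule.
Variables (K : comPzRingType) (G : zmodType) (F : galg K G).
Variables (I : hideal F) (U : gmod K G).
Implicit Types (f : ghom I U) (a b : F).

Fact homr_hdeg g h c (u : F -> U) : hdeg I U g u -> ga_comp F h c ->
  hdeg I U (g + h) (fun m => u (c * m)).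
Proof.
move=> [l1 X1 d1] Cc; split.
- by move=> k x y; rewrite mulrDr -pa_scaleAr l1.
- by move=> x Xx; apply/X1/hi_l.
- by move=> k x Cx; rewrite addrA addrAC [k + h]addrC; exact/d1/ga_M.
Qed.

Fact homr_fsum f a : fsum (hdeg I U) (fun m => hval f (a * m)).
Proof.
apply: (@fsum_op _ _ F I U U (fun a u m => u (a * m)) _ _ _ a
  (hval f) (hval_fsum f)).
- by move=> c k f1 f2; apply/funext.
- move=> f1 [l1 _] k c1 c2; apply/funext => m.
  by rewrite mulrDl -pa_scaleAl l1.
- by move=> g h c f1 Cc D; exact: homr_hdeg.
Qed.
Definition homr f a : ghom I U := insm (homr_fsum f a).

Lemma homrE f a m : hval (homr f a) m = hval f (a * m).
Proof. by []. Qed.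

Fact homr_ract : is_ract homr.
Proof.
split=> /=.
- by move=> a k f1 f2; apply: hval_inj.
- move=> f k a b; apply: hval_inj => m.
  by rewrite hval_lin !homrE mulrDl -pa_scaleAl (ghom_lin f).
- by move=> f; apply: hval_inj => m; rewrite homrE mul1r.
- by move=> f a b; apply: hval_inj => m; rewrite !homrE mulrA.
- by move=> g h f a D Ca; exact: (homr_hdeg D Ca).
Qed.

(** The coinduced module [Hom_K(F / I, U)]: maps from a right [F]-module into it
    are [K]-linear maps into [U] that kill the multiples of [I]. *)
Definition hom_rgmod : rgmod F := RGMod homr_ract.

End HomModule.

Section RelProjProduct.
Variables (K : comPzRingType) (G : zmodType) (F : galg K G).

(** Let [f] vanish on [X I]. On [X] it corresponds to the [F]-linear map
    [x |-> (m |-> f (x m))] into [Hom_K(F / I, V)], which lifts to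
    [Hom_K(F / I, U)] because [X] is projective; evaluation of the lift at [1]
    is a lift of [f] on [X] that vanishes on [X I]. It extends to [F] because
    [X] is a direct summand of [F] over [K]. *)
Theorem relproj_mul (X : rhideal F) (I : hideal F) :
  relproj X -> relproj I -> rg_projective (rh_rgmod X) -> relproj (rh_mul X I).
Proof.
move=> rX rI prX U V p f pd ps fd fXI.
(* [s] is the projection of [F] onto a complement of [X]. *)
have [s [sd sX s_pi]] : exists s : {linear F -> F},
    [/\ @graded_map _ _ (ga_gmod F) (ga_gmod F) s, forall x, X x -> s x = 0
      & forall x, X (x - s x)].
  have pi_deg : @graded_map _ _ (ga_gmod F) (qr_gmod X) (qpi X).
    by move=> g x Cx; exists x.
  have pi_surj (y : qr_gmod X) : exists x, qpi X x = y.
    by exists (repr (y : quotm X)); exact: qpi_repr.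
  have [s [sd sX s_pi]] := rX (ga_gmod F) (qr_gmod X)
    (qpi X : {linear F -> quotm X}) (qpi X : {linear F -> quotm X})
    pi_deg pi_surj pi_deg (fun x => iffRL (qpi0P X x)).
  by exists s; split=> // x; apply/qpi_eq; symmetry; exact: s_pi.
have [k [kd kX kp]] : exists k : {linear F -> U},
    [/\ @graded_map _ _ (ga_gmod F) _ k, forall x, X x -> k x = 0
      & forall x, p (k x) = f (s x)].
  have fsl : linear (fun x => f (s x)) by move=> c x y; rewrite !linearP.
  apply: (rX U V p (lin_of fsl) pd ps).
    by move=> g x Cx; exact/fd/sd.
  by move=> x Xx /=; rewrite sX // linear0.
have XI_X : sm_mul X I `<=` X by exact: rh_mul_sub.
pose b0 (x : rh_rgmod X) (m : F) : V := f (val (x : subm X) * m).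
have b0_linl m : linear (b0^~ m).
  by move=> c x y; rewrite /b0 -linearP; congr (f _); exact: (mul_linl m).
have b0_linr x : linear (b0 x).
  by move=> c m1 m2; rewrite /b0 -linearP; congr (f _); exact: mul_linr.
have b0_I x m : I m -> b0 x m = 0.
  by move=> Im; apply: fXI; apply: sm_mul_in => //; exact: submP.
have b0_deg g h x m :
    gm_comp (rh_rgmod X) g x -> ga_comp F h m -> gm_comp V (h + g) (b0 x m).
  by move=> Cx Cm; apply: fd; rewrite addrC; exact: ga_M.
have [B hB] : exists B : rhom (rh_rgmod X) (hom_rgmod I V),
    forall x m, hval (B x) m = f (val (x : subm X) * m).
  unshelve eexists.
    refine (@RHom _ _ _ (rh_rgmod X) (hom_rgmod I V)
      (curry b0_linl b0_linr b0_I b0_deg) _ _).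
  - move=> x a; apply: hval_inj => m; rewrite homrE.
    rewrite -[LHS]/(f (val (x : subm X) * a * m)).
    by rewrite -[RHS]/(f (val (x : subm X) * (a * m))) mulrA.
  - exact: curry_deg.
  - by [].
have [q hq] : exists q : rhom (hom_rgmod I U) (hom_rgmod I V),
    forall u m, hval (q u) m = p (hval u m).
  pose c0 (u : hom_rgmod I U) (m : F) : V := p (hval u m).
  have c0_linl m : linear (c0^~ m) by move=> k1 x y; exact: linearP.
  have c0_linr x : linear (c0 x).
    by move=> k1 x1 y1; rewrite /c0 (ghom_lin x) linearP.
  have c0_I x m : I m -> c0 x m = 0.
    by move=> Im; rewrite /c0 (ghom_X x Im) linear0.
  have c0_deg g h x m :
      gm_comp (hom_rgmod I U) g x -> ga_comp F h m -> gm_comp V (h + g) (c0 x m).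
    by move=> [_ _ dx] Cm; apply/pd/dx.
  unshelve eexists.
    refine (@RHom _ _ _ (hom_rgmod I U) (hom_rgmod I V)
      (curry c0_linl c0_linr c0_I c0_deg) _ _).
  - by move=> x a; apply: hval_inj.
  - exact: curry_deg.
  - by [].
have q_surj y : exists x, q x = y.
  have [h hh] := ghom_lift rI pd ps y.
  by exists h; apply: hval_inj => m; rewrite hq hh.
have [H hH] := prX _ _ q B q_surj.
have pH x m : p (hval (H x) m) = f (val (x : subm X) * m).
  by rewrite -hq hH hB.
pose rho x : rh_rgmod X := insm (s_pi x).
have rho_lin : linear rho.
  move=> c x y; apply: val_inj => /=.
  by rewrite linearP opprD addrACA scalerBr.
pose h x : U := hval (H (rho x)) 1 + k x.
have hl : linear h.
  move=> c x y; rewrite /h rho_lin !linearP hval_lin.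
  by rewrite scalerDr addrACA.
exists (lin_of hl); split=> /=.
- move=> g x Cx; apply: smD; last exact: kd.
  have Cr : gm_comp (rh_rgmod X) g (rho x) by apply: smB => //; exact: sd.
  have [_ _] : hdeg I U g (hval (H (rho x))) := rh_deg H Cr.
  by move=> /(_ 0 1 (ga_1 F)); rewrite add0r.
- apply: (@sm_mul_ind _ _ F X I (sm_ker (lin_of hl))) => x i Xx Ii.
  have Xxi : X (x * i) by exact: rhi_r.
  rewrite /= /h kX // addr0.
  have -> : rho (x * i) = ract (insm Xx : rh_rgmod X) i.
    by apply: val_inj; rewrite /= sX // subr0.
  by rewrite rh_act homrE mulr1 (ghom_X _ Ii).
- move=> x; rewrite /h linearD pH kp /= mulr1 -linearD subrK.
  by [].
Qed.
End RelProjProduct.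

Section GruenbergIdeals.
Variables (K : comPzRingType) (G : zmodType) (F : galg K G).
Variables (I : hideal F) (J : rhideal F).
Hypothesis IJ : I `<=` J.

(** Treating both parities by one recursion makes the complex of quotients, its
    exactness and its homology uniform in the position. *)
Fixpoint gr_ideal (n : nat) : rhideal F :=
  match n with
  | 0 => rh_top F
  | 1 => J
  | m.+2 => rh_mul (gr_ideal m) I
  end.

Lemma gr_ideal_sub n : gr_ideal n.+1 `<=` gr_ideal n.
Proof.
have H : gr_ideal n.+1 `<=` gr_ideal n /\ gr_ideal n.+2 `<=` gr_ideal n.+1.
  elim: n => [|n [IH1 IH2]].
    by split=> //; apply: sm_mul_ind => x y _ Iy; apply/IJ/hi_l.
  by split=> //; exact: sm_mulS.
exact: H.1.
Qed.

Lemma gr_ideal_even n x : gr_ideal n.*2 x <-> sm_exp I n x.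
Proof.
elim: n x => [//|n IH] x.
by split; apply: sm_mulS => // y /IH.
Qed.

Lemma gr_ideal_odd n x : gr_ideal n.*2.+1 x <-> sm_mul J (sm_exp I n) x.
Proof.
elim: n x => [|n IH] x.
  split=> [Jx|]; last exact: (@rh_mul_sub _ _ F J).
  by rewrite -[x]mulr1; exact: sm_mul_in.
apply: (iff_trans _ (iff_sym (sm_mulA _ _ _ _))).
by split; apply: sm_mulS => // y /IH.
Qed.

Lemma gr_ideal_projective : quasi_free F -> relproj I -> relproj J ->
  forall n, relproj (gr_ideal n) /\ rg_projective (rh_rgmod (gr_ideal n)).
Proof.
move=> qF rI rJ n; have pr (m : nat) : relproj (gr_ideal m) ->
    relproj (gr_ideal m) /\ rg_projective (rh_rgmod (gr_ideal m)).
  by move=> r; split=> //; exact: quasi_free_rh_projective.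
have [] : (relproj (gr_ideal n) /\ rg_projective (rh_rgmod (gr_ideal n))) /\
    (relproj (gr_ideal n.+1) /\ rg_projective (rh_rgmod (gr_ideal n.+1))).
  elim: n => [|n [[r0 p0] r1]].
    by split; apply: pr => //; exact: relproj_top.
  by split=> //; apply: pr; exact: relproj_mul.
by [].
Qed.
End GruenbergIdeals.

(** * Comparison of resolutions *)

Section Subquotients.
Variables (K : pzRingType) (V V' : lmodType K).
Variables (Z B : submod V) (Z' B' : submod V') (R : V -> V' -> Prop).
Hypothesis R_lin : forall (k : K) x y x' y',
  R x x' -> R y y' -> R (k *: x + y) (k *: x' + y').
Hypothesis R_total : forall z, Z z -> exists2 z', Z' z' & R z z'.
Hypothesis R_surj : forall z', Z' z' -> exists2 z, Z z & R z z'.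
Hypothesis R_B : forall z z', Z z -> Z' z' -> R z z' -> (B z <-> B' z').

(** Working with a relation instead of a map covers both uses: a chain map that
    is invertible only up to boundaries, and a map defined only on a submodule
    of [V']. *)
Lemma subquot_iso :
  exists f : {linear subquot Z B -> subquot Z' B'}, bijective f.
Proof.
pose W' := sm_preim (val : {linear subm Z' -> V'}) B'.
pose W := sm_preim (val : {linear subm Z -> V}) B.
have /choice[c Rc] (z : subm Z) : exists z' : subm Z', R (val z) (val z').
  by have [z' Zz' Rz] := R_total (submP z); exists (insm Zz').
have RW (z : subm Z) (z' : subm Z') : R (val z) (val z') -> W z <-> W' z'.
  by apply: R_B; exact: submP.
have uniq_c (z : subm Z) (z' : subm Z') : R (val z) (val z') -> W' (c z - z').
  move=> Rz; apply/(RW 0); last exact: sm_0.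
  by have := R_lin (-1) Rz (Rc z); rewrite !scaleN1r addNr [- _ + _]addrC.
have fl : linear (fun z => qpi W' (c z)).
  move=> k x y; rewrite -linearP; apply/qpi_eq/uniq_c.
  by have := R_lin k (Rc x) (Rc y).
have fW : W `<=` sm_ker (lin_of fl) by move=> z Wz; apply/qpi0P/(RW z).
exists (qlift_lin fW).
have qE z : qlift_lin fW (qpi W z) = qpi W' (c z) := qliftE fW z.
have inj : injective (qlift_lin fW).
  move=> x y; rewrite -[x]qpi_repr -[y]qpi_repr => e; apply/qpi_eq.
  apply/(RW _ _ (Rc _))/qpi0P.
  rewrite -[LHS]/(lin_of fl _) linearB; apply/eqP; rewrite subr_eq0; apply/eqP.
  by move: e; rewrite !qE.
have surj y : exists x, qlift_lin fW x = y.
  have [z Zz Rz] := R_surj (submP (repr (y : quotm W'))).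
  exists (qpi W (insm Zz)); rewrite qE -[RHS]qpi_repr.
  exact/qpi_eq/uniq_c.
have /choice[g gK] := surj.
by exists g => // x; apply: inj; rewrite gK.
Qed.
End Subquotients.

Section RHoms.
Variables (K : comPzRingType) (G : zmodType) (A : galg K G).

Definition rhom_id (M : rgmod A) : rhom M M.
Proof. by refine (@RHom _ _ _ M M (idfun : {linear M -> M}) _ _). Defined.

Section Comp.
Variables (L M N : rgmod A) (f : rhom M N) (g : rhom L M).
Fact rhom_comp_linear : linear (fun x => f (g x)).
Proof. by move=> k x y; rewrite !linearP. Qed.
Definition rhom_comp : rhom L N.
Proof.
refine (@RHom _ _ _ L N (lin_of rhom_comp_linear) _ _).
- by move=> x a; rewrite /= !rh_act.
- by move=> h x Cx; exact: (rh_deg f (rh_deg g Cx)).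
Defined.
Lemma rhom_compE x : rhom_comp x = f (g x). Proof. by []. Qed.
End Comp.

Section Sub.
Variables (M N : rgmod A) (f g : rhom M N).
Fact rhom_sub_linear : linear (fun x => f x - g x).
Proof. by move=> k x y; rewrite (linearP f) (linearP g) opprD addrACA scalerBr. Qed.
Definition rhom_sub : rhom M N.
Proof.
refine (@RHom _ _ _ M N (lin_of rhom_sub_linear) _ _).
- by move=> x a; rewrite /= !rh_act (lin_funB (ract_linl (ractP N) a)).
- by move=> h x Cx; apply: smB; [exact: (rh_deg f)|exact: (rh_deg g)].
Defined.
Lemma rhom_subE x : rhom_sub x = f x - g x. Proof. by []. Qed.
End Sub.

(** Projectivity is used for the surjection of [M] onto the image of [d]. *)
Lemma projective_lift (P M N : rgmod A) (d : rhom M N) (f : rhom P N) :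
  rg_projective P -> (forall x, exists y, d y = f x) ->
  exists h : rhom P M, forall x, d (h x) = f x.
Proof.
move=> prP fd; pose W := sm_img d (sm_top M).
have hW : homogeneous (gm_comp N) W.
  apply/(homogeneousP (gm_grading N)) => g _ [x _ <-].
  exists (hpart (gm_grading M) g x) => //.
  exact: (hpart_map (@rh_deg _ _ _ _ _ d)).
have aW x a : W x -> W (ract x a).
  by move=> [y _ <-]; exists (ract y a) => //; rewrite rh_act.
have Wd y : W (d y) by exists y.
have Wf x : W (f x) by have [y <-] := fd x.
have dl : linear (fun y => insm (Wd y)).
  by move=> k x y; apply: val_inj; exact: linearP.
have fl : linear (fun x => insm (Wf x)).
  by move=> k x y; apply: val_inj; exact: linearP.
have [d' hd'] : exists d' : rhom M (sub_rgmod hW aW), forall y, d' y = insm (Wd y).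
  unshelve eexists;
    first refine (@RHom _ _ _ M (sub_rgmod hW aW) (lin_of dl) _ _).
  - by move=> x a; apply: val_inj; exact: rh_act.
  - by move=> g x Cx; exact: rh_deg.
  - by [].
have [f' hf'] : exists f' : rhom P (sub_rgmod hW aW), forall y, f' y = insm (Wf y).
  unshelve eexists;
    first refine (@RHom _ _ _ P (sub_rgmod hW aW) (lin_of fl) _ _).
  - by move=> x a; apply: val_inj; exact: rh_act.
  - by move=> g x Cx; exact: rh_deg.
  - by [].
have [|h hh] := prP _ _ d' f'.
  move=> y; have [x _ ex] := submP (y : subm W).
  by exists x; rewrite hd'; apply: val_inj.
by exists h => x; have := congr1 val (hh x); rewrite hd' hf'.
Qed.

Variable S : rgmod A.

Lemma res_dd (P : gresolution S) n x : res_d P n (res_d P n.+1 x) = 0.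
Proof. by apply/res_exact; exists x. Qed.

Lemma res_aug_d (P : gresolution S) x : res_aug P (res_d P 0 x) = 0.
Proof. by apply/res_exact0; exists x. Qed.

Record chain_map (P Q : gresolution S) := ChainMap {
  cm_fun :> forall n, rhom (res_mod P n) (res_mod Q n);
  cm_aug : forall x, res_aug Q (cm_fun 0 x) = res_aug P x;
  cm_d : forall n x, res_d Q n (cm_fun n.+1 x) = cm_fun n (res_d P n x)
}.

Lemma chain_map_exists (P Q : gresolution S) : inhabited (chain_map P Q).
Proof.
(* A map that sends boundaries to boundaries has a next one, which then does so
   too. *)
pose good n (a : rhom (res_mod P n) (res_mod Q n)) :=
  forall x, exists y, res_d Q n y = a (res_d P n x).
have [a0 ha0] : exists a : rhom (res_mod P 0) (res_mod Q 0),
    forall x, res_aug Q (a x) = res_aug P x.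
  apply: (@projective_lift _ _ _ (res_aug Q) _ (@res_proj _ _ _ _ P 0)) => x.
  exact: res_surj.
have g0 : good 0 a0.
  by move=> x; apply/res_exact0; rewrite ha0 res_aug_d.
have step n (a : {a | good n a}) : {b : {b | good n.+1 b} |
    forall x, res_d Q n (sval b x) = sval a (res_d P n x)}.
  apply: cid; case: a => a ga /=.
  have [b hb] := projective_lift (f := rhom_comp a (res_d P n))
    (@res_proj _ _ _ _ P n.+1) ga.
  have gb : good n.+1 b.
    by move=> x; apply/res_exact; rewrite hb rhom_compE res_dd linear0.
  by exists (exist _ b gb).
pose al := fix al n : {a | good n a} :=
  if n is m.+1 then sval (step m (al m)) else exist _ a0 g0.
constructor; apply: (@ChainMap P Q (fun n => sval (al n))) => // n.
exact: svalP (step n (al n)).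
Qed.

Definition chain_comp (P Q T : gresolution S) (b : chain_map Q T)
  (a : chain_map P Q) : chain_map P T.
Proof.
refine (@ChainMap P T (fun n => rhom_comp (b n) (a n)) _ _).
- by move=> x; rewrite rhom_compE !cm_aug.
- by move=> n x; rewrite !rhom_compE !cm_d.
Defined.

(** In the recursion, the map [s n] need only be known to satisfy the homotopy
    identity on boundaries: this makes [c (n + 1) - id - s n d] land in the
    kernel of [d n], hence in the image of [d (n + 1)]. *)
Lemma chain_homotopy (P : gresolution S) (c : chain_map P P) :
  exists s : forall n, rhom (res_mod P n) (res_mod P n.+1),
    (forall x, res_d P 0 (s 0 x) = c 0 x - x) /\
    (forall n x, res_d P n.+1 (s n.+1 x) + s n (res_d P n x) = c n.+1 x - x).
Proof.
pose good n (s : rhom (res_mod P n) (res_mod P n.+1)) :=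
  forall x, res_d P n (s (res_d P n x)) = c n (res_d P n x) - res_d P n x.
have [s0 hs0] : exists s : rhom (res_mod P 0) (res_mod P 1),
    forall x, res_d P 0 (s x) = rhom_sub (c 0) (rhom_id _) x.
  apply: (@projective_lift _ _ _ (res_d P 0) _ (@res_proj _ _ _ _ P 0)) => x.
  apply/res_exact0.
  by rewrite rhom_subE linearB cm_aug subrr.
have g0 : good 0 s0 by move=> x; rewrite hs0.
have step n (s : {s | good n s}) : {t : {t | good n.+1 t} |
    forall x, res_d P n.+1 (sval t x) + sval s (res_d P n x) = c n.+1 x - x}.
  apply: cid; case: s => s gs /=.
  have [|t ht] := @projective_lift _ _ _ (res_d P n.+1)
    (rhom_sub (rhom_sub (c n.+1) (rhom_id _)) (rhom_comp s (res_d P n)))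
    (@res_proj _ _ _ _ P n.+1).
    move=> x; apply/res_exact.
    by rewrite !rhom_subE rhom_compE !linearB cm_d gs subrr.
  have gt : good n.+1 t.
    by move=> x; rewrite ht !rhom_subE rhom_compE res_dd linear0 subr0.
  exists (exist _ t gt) => x /=.
  by rewrite ht !rhom_subE rhom_compE subrK.
pose al := fix al n : {a | good n a} :=
  if n is m.+1 then sval (step m (al m)) else exist _ s0 g0.
exists (fun n => sval (al n)); split=> // n.
exact: svalP (step n (al n)).
Qed.
End RHoms.

(** * Independence of Tor of the resolution *)

Section TensorGenerators.
Variables (K : comPzRingType) (G : zmodType) (A : galg K G).

Lemma freem_ind (X : choiceType) (W : submod (freem K X)) :
  (forall x, W (fdelta K x)) -> forall f, W f.
Proof.
move=> Wd f; suff -> : f = flift (fun x => fdelta K x) f.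
  have /finite_fsetP[S eS] := submP f.
  rewrite (@fliftE _ _ _ _ _ S); last by rewrite [fsupp _]eS.
  by apply: sm_sum => x; apply: smZ.
have /finite_fsetP[S eS] := submP f.
rewrite (@fliftE _ _ _ _ _ S); last by rewrite [fsupp _]eS.
apply: val_inj; apply/funext => y.
rewrite (linear_sum (val : {linear freem K X -> (X -> K^o)})) fct_sumE /=.
have [yS|yS] := boolP (y \in S).
  rewrite (bigD1_seq y) ?fset_uniq //= big1 => [|x xy].
    by rewrite addr0 -[RHS]/(val f y * (y == y)%:R) eqxx mulr1.
  by rewrite -[LHS]/(val f x * (y == x)%:R) eq_sym (negPf xy) mulr0.
rewrite big1_seq => [|x /andP[_ xS]].
  apply/eqP; apply: contraNT yS => fy.
  by have : fsupp (val f) y by []; rewrite [fsupp _]eS.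
rewrite -[LHS]/(val f x * (y == x)%:R).
case: (y =P x) => [e|_]; last by rewrite mulr0.
by rewrite -e (negPf yS) in xS.
Qed.

Variables (M : rgmod A) (N : lgmod A).

Lemma tens_ind (W : submod (tens M N)) :
  (forall x y, W (pure x y)) -> forall t, W t.
Proof.
move=> Wp t; rewrite -[t]qpi_repr.
pose q := qpi (Defs.span (@tens_rel _ _ _ M N)).
apply: (@freem_ind _ (sm_preim (q : {linear _ -> tens M N}) W)) => -[x y].
exact: Wp.
Qed.

Lemma tens_ext (T : lmodType K) (f g : tens M N -> T) :
  linear f -> linear g -> (forall x y, f (pure x y) = g (pure x y)) ->
  forall t, f t = g t.
Proof.
move=> fl gl fg t; apply/eqP; rewrite -subr_eq0; apply/eqP.
have hl : linear (fun t => f t - g t).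
  by move=> k x y; rewrite fl gl opprD addrACA scalerBr.
by apply: (@tens_ind (sm_ker (lin_of hl))) => x y /=; rewrite fg subrr.
Qed.
End TensorGenerators.

Section TensorMaps.
Variables (K : comPzRingType) (G : zmodType) (A : galg K G).
Variables (L M M' : rgmod A) (N : lgmod A).

Lemma pure_linl_sub (x x' : M) (y : N) : pure (x - x') y = pure x y - pure x' y.
Proof. exact: (lin_funB (pure_linl y)). Qed.

Lemma tens_map_comp (f : rhom M M') (g : rhom L M) (h : rhom L M') :
  (forall x, h x = f (g x)) ->
  forall t, tens_map N h t = tens_map N f (tens_map N g t).
Proof.
move=> hfg; apply: tens_ext; first exact: linearP.
- by move=> k x y; rewrite !linearP.
- by move=> x y; rewrite !tens_map_pure hfg.
Qed.

Lemma tens_map_deg (f : rhom M M') g t :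
  tens_comp M N g t -> tens_comp M' N g (tens_map N f t).
Proof.
move=> Ct; apply: (Ct (sm_preim (tens_map N f) (tens_comp M' N g))).
move=> _ [h [i [x [y [Cx Cy e ->]]]]].
apply: span_sub; rewrite tens_map_pure; exists h, i, (f x), y; split=> //.
exact: rh_deg.
Qed.
End TensorMaps.

Lemma graded_isoI (K : pzRingType) (G : Type) (U W : G -> lmodType K) :
  (forall g, exists f : {linear U g -> W g}, bijective f) -> graded_iso U W.
Proof.
move=> H; exists (fun g => projT1 (cid (H g))) => g.
exact: projT2 (cid (H g)).
Qed.

Section TorComparison.
Variables (K : comPzRingType) (G : zmodType) (A : galg K G).
Variables (S : rgmod A) (N : lgmod A).

Lemma tens_map_d (P Q : gresolution S) (a : chain_map P Q) n t :
  tens_map N (res_d Q n) (tens_map N (a n.+1) t) =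
  tens_map N (a n) (tens_map N (res_d P n) t).
Proof.
pose h := rhom_comp (a n) (res_d P n).
have hP x : h x = a n (res_d P n x) by [].
have hQ x : h x = res_d Q n (a n.+1 x) by rewrite cm_d.
by rewrite -(tens_map_comp hP) -(tens_map_comp hQ).
Qed.

Lemma tor_cycles_map (P Q : gresolution S) (a : chain_map P Q) n t :
  tor_cycles P N n t -> tor_cycles Q N n (tens_map N (a n) t).
Proof.
case: n t => [//|n] t Zt; rewrite -[tor_cycles _ _ _ _]/(_ = 0) tens_map_d.
by rewrite [tens_map N (res_d P n) t]Zt linear0.
Qed.

Lemma tor_boundaries_map (P Q : gresolution S) (a : chain_map P Q) n t :
  tor_boundaries P N n t -> tor_boundaries Q N n (tens_map N (a n) t).
Proof.
by move=> [u _ <-]; exists (tens_map N (a n.+1) u); rewrite ?tens_map_d.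
Qed.

Lemma tor_homotopy (P : gresolution S) (c : chain_map P P) n t :
  tor_cycles P N n t -> tor_boundaries P N n (tens_map N (c n) t - t).
Proof.
have [s [s0 sS]] := chain_homotopy c.
case: n t => [|n] t Zt.
  exists (tens_map N (s 0) t) => //; move: t {Zt}; apply: tens_ext.
  - by move=> k x y; rewrite !linearP.
  - by move=> k x y; rewrite linearP opprD addrACA scalerBr.
  - by move=> x y; rewrite !tens_map_pure s0 pure_linl_sub.
exists (tens_map N (s n.+1) t) => //.
suff <- : tens_map N (res_d P n.+1) (tens_map N (s n.+1) t) +
    tens_map N (s n) (tens_map N (res_d P n) t) = tens_map N (c n.+1) t - t.
  by rewrite [tens_map N (res_d P n) t]Zt linear0 addr0.
move: t {Zt}; apply: tens_ext.
- by move=> k x y; rewrite !linearP addrACA scalerDr.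
- by move=> k x y; rewrite linearP opprD addrACA scalerBr.
- move=> x y; rewrite !tens_map_pure -pure_linl_sub -sS.
  by rewrite (lin_funD (pure_linl y)).
Qed.

Theorem tor_indep (P Q : gresolution S) n :
  graded_iso (tor P N n) (tor Q N n).
Proof.
have [a] := chain_map_exists P Q; have [b] := chain_map_exists Q P.
apply: graded_isoI => g.
pose R t u := tor_boundaries Q N n (tens_map N (a n) t - u).
have ab t : tor_cycles Q N n t ->
    tor_boundaries Q N n (tens_map N (a n) (tens_map N (b n) t) - t).
  move=> /(tor_homotopy (chain_comp a b)).
  by rewrite (@tens_map_comp _ _ _ _ _ _ _ (a n) (b n)).
have ba t : tor_cycles P N n t ->
    tor_boundaries P N n (tens_map N (b n) (tens_map N (a n) t) - t).
  move=> /(tor_homotopy (chain_comp b a)).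
  by rewrite (@tens_map_comp _ _ _ _ _ _ _ (b n) (a n)).
apply: (@subquot_iso _ _ _ _ _ _ _ R).
- move=> k x y x' y'; rewrite /R linearP opprD addrACA -scalerBr.
  exact: sm_lin.
- move=> t [Zt Ct]; exists (tens_map N (a n) t).
    by split; [exact: tor_cycles_map|exact: tens_map_deg].
  by rewrite /R subrr; exact: sm_0.
- move=> u [Zu Cu]; exists (tens_map N (b n) u).
    by split; [exact: tor_cycles_map|exact: tens_map_deg].
  exact: ab.
- move=> t u [Zt Ct] [Zu Cu] Rtu; split=> -[] B _; split=> //.
    rewrite -[u](subKr (tens_map N (a n) t)); apply: smB => //.
    exact: tor_boundaries_map.
  rewrite -[t](subKr (tens_map N (b n) (tens_map N (a n) t))).
  apply: smB; last exact: ba.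
  apply: tor_boundaries_map; rewrite -[tens_map _ _ _](subrK u).
  exact: smD.
Qed.
End TorComparison.

Lemma graded_iso_trans (K : pzRingType) (G : Type) (T U W : G -> lmodType K) :
  graded_iso T U -> graded_iso U W -> graded_iso T W.
Proof.
move=> [f hf] [h hh].
have l g : linear (fun x => h g (f g x)) by move=> k x y; rewrite !linearP.
exists (fun g => lin_of (l g)) => g.
exact: (bij_comp (hh g) (hf g)).
Qed.

(** * The resolution by successive quotients *)

Section GradedPiece.
Variables (K : comPzRingType) (G : zmodType) (F : galg K G) (I : hideal F).

Section Object.
Variable X : rhideal F.
Local Notation XM := (rh_rgmod X).

Definition piece_den : submod XM :=
  sm_preim (val : {linear subm X -> F}) (sm_mul X I).

Fact piece_den_hom : homogeneous (gm_comp XM) piece_den.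
Proof.
move=> s c us Cc; rewrite /piece_den /= /preimage /= => H g gs.
have := @rhi_hom _ _ _ (rh_mul X I) s (fun g => val (c g : subm X)) us Cc.
by rewrite -linear_sum; apply.
Qed.

Definition piece_gmod : gmod K G :=
  GMod (quot_grading (gm_grading XM) piece_den_hom).

Definition pcl (x : subm X) : piece_gmod := qpi piece_den x.

Lemma pcl_linear : linear pcl.
Proof. exact: (linearP (qpi piece_den)). Qed.

Lemma pcl_surj (q : piece_gmod) : exists x, pcl x = q.
Proof. by exists (repr (q : quotm piece_den)); exact: qpi_repr. Qed.

Lemma pcl_eq x y : pcl x = pcl y <-> sm_mul X I (val x - val y).
Proof. exact: qpi_eq. Qed.

Lemma pcl_eq0 x : pcl x = 0 <-> sm_mul X I (val x).
Proof. exact: qpi0P. Qed.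

Definition rmulX (x : subm X) (a : F) : subm X :=
  insm (@rhi_r _ _ _ X a _ (submP x)).

Definition piece_act (q : piece_gmod) (a : quot_galg I) : piece_gmod :=
  pcl (rmulX (repr (q : quotm piece_den)) (repr (a : quotm I))).

Lemma piece_actE x a : piece_act (pcl x) (qpi I a) = pcl (rmulX x a).
Proof.
apply/pcl_eq; set x' := repr _; set a' := repr _.
rewrite -[val _ - _]/(val x' * a' - val x * a).
rewrite -[val x' * a'](subrK (val x' * a)) -mulrBr -addrA -mulrBl; apply: smD.
- by apply: sm_mul_in; [exact: submP|exact: repr_qpi].
- apply: rh_mul_r; exact: (repr_qpi piece_den x).
Qed.

Fact piece_is_ract : is_ract piece_act.
Proof.
split=> /=.
- move=> a k p q; have [x <-] := pcl_surj p; have [y <-] := pcl_surj q.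
  rewrite -[a]qpi_repr -pcl_linear !piece_actE -pcl_linear; congr pcl.
  by apply: val_inj; exact: mul_linl.
- move=> p k a b; have [x <-] := pcl_surj p.
  rewrite -[a]qpi_repr -[b]qpi_repr -linearP !piece_actE -pcl_linear.
  by congr pcl; apply: val_inj; exact: mul_linr.
- move=> p; have [x <-] := pcl_surj p.
  by rewrite piece_actE; congr pcl; apply: val_inj; exact: mulr1.
- move=> p a b; have [x <-] := pcl_surj p.
  rewrite -[a]qpi_repr -[b]qpi_repr quot_galgM !piece_actE.
  by congr pcl; apply: val_inj; exact: mulrA.
- move=> g h _ _ [x Cx <-] [a Ca <-].
  rewrite -[qpi piece_den x]/(pcl x) piece_actE; exists (rmulX x a) => //.
  exact: ga_M.
Qed.
Definition piece : rgmod (quot_galg I) := RGMod piece_is_ract.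

Lemma piece_ractE x a : ract (pcl x : piece) (qpi I a) = pcl (rmulX x a).
Proof. exact: piece_actE. Qed.

End Object.

Section Restriction.
Variable U : rgmod (quot_galg I).

Definition restrict_act (x : U) (a : F) : U := ract x (qpi I a).
Fact restrict_is_ract : is_ract restrict_act.
Proof.
have H := ractP U; split; rewrite /restrict_act.
- by move=> a; exact: (ract_linl H).
- by move=> x k a b; rewrite linearP (ract_linr H).
- exact: (ract_1 H).
- by move=> x a b; rewrite -quot_galgM (ract_M H).
- move=> g h x a Cx Ca; apply: (ract_deg H) => //; by exists a.
Qed.
Definition restrict : rgmod F := RGMod restrict_is_ract.
End Restriction.

(** Projectivity descends along [F -> F / I]: a lift defined on [X] takes
    values in an [F / I]-module, so it kills [X I]. *)
Lemma piece_projective (X : rhideal F) :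
  rg_projective (rh_rgmod X) -> rg_projective (piece X).
Proof.
move=> prX U V p f ps.
pose p' : rhom (restrict U) (restrict V) :=
  @RHom _ _ _ (restrict U) (restrict V) p
    (fun x a => rh_act p x (qpi I a)) (@rh_deg _ _ _ _ _ p).
have fl : linear (fun x : subm X => f (pcl x)).
  by move=> k x y; rewrite pcl_linear linearP.
have [f' hf'] : exists f' : rhom (rh_rgmod X) (restrict V),
    forall x, f' x = f (pcl x).
  unshelve eexists;
    first refine (@RHom _ _ _ (rh_rgmod X) (restrict V) (lin_of fl) _ _).
  - move=> x a; rewrite -[RHS]/(ract (f (pcl x)) (qpi I a)) -rh_act piece_ractE.
    by [].
  - by move=> g x Cx; apply: rh_deg; exists x.
  - by [].
have [h hh] := prX _ _ p' f' ps.
have hI : piece_den X `<=` sm_ker h.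
  move=> x Wx; suff [y /= hy exy] :
      sm_img (val : {linear subm X -> F}) (sm_ker h) (val x).
    by rewrite /= -(val_inj exy).
  apply: (@sm_mul_ind _ _ F X I) Wx => a i Xa Ii.
  exists (rmulX (insm Xa) i) => //=.
  rewrite -[LHS]/(h (ract (insm Xa : rh_rgmod X) i)) rh_act.
  rewrite -[LHS]/(ract (h (insm Xa) : U) (qpi I i)).
  have /qpi0P -> := Ii.
  exact: (lin_fun0 (ract_linr (ractP U) _)).
have hE x : qlift_lin hI (pcl x) = h x := qliftE hI x.
unshelve eexists; first refine (@RHom _ _ _ (piece X) U (qlift_lin hI) _ _).
- move=> q a; have [x <-] := pcl_surj q; rewrite -[a]qpi_repr piece_ractE !hE.
  exact: (rh_act h).
- by move=> g _ [x Cx <-]; rewrite [qlift_lin _ _]hE; exact: (rh_deg h).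
- move=> q; have [x <-] := pcl_surj q; rewrite -hf' -hh.
  by congr (p _); exact: hE.
Qed.

Section Map.
Variables (X Y : rhideal F) (YX : Y `<=` X).

Definition incl (y : subm Y) : subm X := insm (YX (submP y)).

Fact incl_linear : linear (fun y => pcl (incl y)).
Proof.
by move=> k x y; rewrite -pcl_linear; congr pcl; exact: val_inj.
Qed.

Fact incl_den : piece_den Y `<=` sm_ker (lin_of incl_linear).
Proof.
by move=> y Yy; apply/pcl_eq0; apply: sm_mulS Yy.
Qed.

Fact piece_map_act (q : piece Y) a :
  qlift_lin incl_den (ract q a) = ract (qlift_lin incl_den q : piece X) a.
Proof.
have hE y : qlift_lin incl_den (pcl y) = pcl (incl y) := qliftE incl_den y.
have [y <-] := pcl_surj q; rewrite -[a]qpi_repr piece_ractE !hE piece_ractE.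
by congr pcl; exact: val_inj.
Qed.

Fact piece_map_deg g (q : piece Y) :
  gm_comp (piece Y) g q -> gm_comp (piece X) g (qlift_lin incl_den q).
Proof.
move=> [y Cy <-]; rewrite [qlift_lin _ _](qliftE incl_den).
by exists (incl y).
Qed.

Definition piece_map : rhom (piece Y) (piece X) :=
  @RHom _ _ _ (piece Y) (piece X) (qlift_lin incl_den) piece_map_act piece_map_deg.

Lemma piece_mapE y : piece_map (pcl y) = pcl (incl y).
Proof. exact: (qliftE incl_den y). Qed.
End Map.
End GradedPiece.

Section Resolution.
Variables (K : comPzRingType) (G : zmodType) (F : galg K G).
Variables (I : hideal F) (J : rhideal F).
Hypothesis IJ : I `<=` J.
Local Notation X := (gr_ideal I J).
Local Notation S := (quot_rgmod IJ).
Local Notation Q n := (piece I (X n)).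

Hypothesis qF : quasi_free F.
Hypothesis rI : relproj I.
Hypothesis rJ : relproj J.

Fact aug_linear : linear (fun x : subm (X 0) => qpi J (val x)).
Proof. by move=> k x y; rewrite !linearP. Qed.

Fact aug_den : piece_den I (X 0) `<=` sm_ker (lin_of aug_linear).
Proof.
move=> x /= Wx; apply/qpi0P; move: Wx.
by apply: (@sm_mul_ind _ _ F (X 0) I) => a i _ Ii; apply/IJ/hi_l.
Qed.

Local Notation aug := (qlift_lin aug_den).

Lemma augE x : aug (pcl I x) = qpi J (val x).
Proof. exact: (qliftE aug_den x). Qed.

Fact aug_act (q : Q 0) a : aug (ract q a) = ract (aug q : S) a.
Proof.
have [x <-] := pcl_surj q; rewrite -[a]qpi_repr piece_ractE !augE.
symmetry; exact: (qr_actE IJ).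
Qed.

Fact aug_deg g (q : Q 0) : gm_comp (Q 0) g q -> gm_comp S g (aug q).
Proof. by move=> [x Cx <-]; rewrite [aug _]augE; exists (val x). Qed.

Definition gr_aug : rhom (Q 0) S := @RHom _ _ _ (Q 0) S aug aug_act aug_deg.

Definition gr_d n : rhom (Q n.+1) (Q n) :=
  piece_map I (@gr_ideal_sub _ _ F I J IJ n).

Lemma gr_exact0 q : gr_aug q = 0 <-> exists y, gr_d 0 y = q.
Proof.
split=> [|[y <-]].
  have [x <-] := pcl_surj q; rewrite [gr_aug _]augE => /qpi0P Jx.
  exists (pcl I (insm (Jx : X 1 (val x)))); rewrite [gr_d 0 _]piece_mapE.
  by congr pcl; exact: val_inj.
have [x <-] := pcl_surj y; rewrite [gr_d 0 _]piece_mapE [gr_aug _]augE.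
by apply/qpi0P; exact: (submP x).
Qed.

(** The kernel of [X (n+1) / X (n+1) I -> X n / X n I] is [X n I / X (n+1) I],
    and [X n I] is the next ideal of the filtration. *)
Lemma gr_exact n q : gr_d n q = 0 <-> exists y, gr_d n.+1 y = q.
Proof.
split=> [|[y <-]].
  have [x <-] := pcl_surj q; rewrite [gr_d _ _]piece_mapE => /pcl_eq0 XI.
  exists (pcl I (insm (XI : X n.+2 (val x)))); rewrite [gr_d _ _]piece_mapE.
  by congr pcl; exact: val_inj.
have [x <-] := pcl_surj y.
rewrite [gr_d n.+1 _]piece_mapE [gr_d n _]piece_mapE.
by apply/pcl_eq0; exact: (submP x).
Qed.

Lemma gr_surj s : exists x, gr_aug x = s.
Proof.
exists (pcl I (insm (Logic.I : X 0 (repr (s : quotm J))))).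
by rewrite [gr_aug _]augE; exact: qpi_repr.
Qed.

Definition gr_resolution : gresolution S :=
  @GResolution _ _ _ S (fun n => Q n) gr_d gr_aug
    (fun n => piece_projective (gr_ideal_projective qF rI rJ n).2)
    gr_surj gr_exact0 gr_exact.
End Resolution.

(** * Tensor product with a cyclic left module *)

Section PieceTensor.
Variables (K : comPzRingType) (G : zmodType) (F : galg K G).
Variables (I : hideal F) (J' : lhideal F).
Hypothesis IJ' : I `<=` J'.
Local Notation S' := (quot_lgmod IJ').

Section Object.
Variable X : rhideal F.
Local Notation T := (tens (piece I X) S').

Definition one' : S' := qpi J' (1 : F).

Lemma one'_gen (v : F) : lact (qpi I v : quot_galg I) one' = qpi J' v.
Proof. by rewrite -[LHS]/(ql_act _ _) (ql_actE IJ') mulr1. Qed.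

Lemma lactE (a u : F) :
  lact (qpi I a : quot_galg I) (qpi J' u : S') = qpi J' (a * u).
Proof. exact: (ql_actE IJ'). Qed.

(** Tensoring with the class of [1] induces the isomorphism of [X / X J'] with
    the tensor product. *)
Definition iota_fun (x : subm X) : T := pure (pcl I x : piece I X) one'.
Fact iota_linear : linear iota_fun.
Proof. by move=> k x y; rewrite /iota_fun pcl_linear pure_linl. Qed.
Definition iota : {linear subm X -> T} := lin_of iota_linear.

Lemma pure_iota (x : subm X) (v : F) :
  pure (pcl I x : piece I X) (qpi J' v : S') = iota (rmulX x v).
Proof. by rewrite -one'_gen -pure_act piece_ractE. Qed.

(** The pairing that gives the inverse isomorphism; it detects the kernel of
    [iota]. *)
Definition mult (q : piece I X) (s : S') : quotm (sm_mul X J') :=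
  qpi (sm_mul X J')
    (val (repr (q : quotm (piece_den I X)) : subm X) * repr (s : quotm J')).

Lemma multE (x : subm X) (v : F) :
  mult (pcl I x) (qpi J' v) = qpi (sm_mul X J') (val x * v).
Proof.
apply/qpi_eq; set x' := repr _; set v' := repr _.
rewrite -[val x' * v'](subrK (val x' * v)) -mulrBr -addrA -mulrBl; apply: smD.
  by apply: sm_mul_in; [exact: submP|exact: repr_qpi].
have : sm_mul X I (val x' - val x) by apply/pcl_eq; exact: qpi_repr.
apply: (sm_mul_ind_lin (mul_linl v)) => a i Xa Ii.
by rewrite -mulrA; apply: sm_mul_in => //; apply/IJ'/hi_r.
Qed.

Fact mult_linl s : linear (mult^~ s).
Proof.
move=> k p q; have [x <-] := pcl_surj p; have [y <-] := pcl_surj q.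
rewrite -[s]qpi_repr -pcl_linear !multE -linearP; congr (qpi _ _).
exact: mul_linl.
Qed.
Fact mult_linr q : linear (mult q).
Proof.
move=> k s t; have [x <-] := pcl_surj q.
rewrite -[s]qpi_repr -[t]qpi_repr -linearP !multE -linearP; congr (qpi _ _).
exact: mul_linr.
Qed.
Fact mult_act q a s : mult (ract q a) s = mult q (lact a s).
Proof.
have [x <-] := pcl_surj q; rewrite -[a]qpi_repr -[s]qpi_repr.
by rewrite piece_ractE lactE !multE mulrA.
Qed.

Lemma iota_eq0 (x : subm X) : iota x = 0 <-> sm_mul X J' (val x).
Proof.
split=> [e|].
  have := tens_lift_pure (Balanced mult_linl mult_linr mult_act) (pcl I x) one'.
  rewrite [pure _ _]e linear0 -[RHS]/(mult _ _) multE mulr1 => /esym.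
  by move/qpi0P.
move=> Xx; suff [y /= <- /val_inj <-//] :
    sm_img (val : {linear subm X -> F}) (sm_ker iota) (val x).
move: Xx; apply: sm_mul_ind => a b Xa Jb.
exists (rmulX (insm Xa) b) => //.
rewrite -[sm_ker _ _]/(iota _ = 0) -pure_iota.
by have /qpi0P -> := Jb; exact: (lin_fun0 (pure_linr _)).
Qed.

Lemma iota_surj t : exists x, iota x = t.
Proof.
have [] : sm_img iota (sm_top _) t; last by move=> x _ <-; exists x.
move: t; apply: tens_ind => q s; have [x <-] := pcl_surj q.
by rewrite -[s]qpi_repr pure_iota; exists (rmulX x (repr (s : quotm J'))).
Qed.

Lemma iota_comp g t : tens_comp (piece I X) S' g t <->
  exists2 x : subm X, ga_comp F g (val x) & iota x = t.
Proof.
split=> [Ct|[x Cx <-]].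
  apply: (Ct (sm_img iota (sm_preim (val : {linear subm X -> F}) (ga_comp F g)))).
  move=> _ [h [i [q [s [[x Cx <-] [v Cv <-] <- ->]]]]].
  exists (rmulX x v); last by rewrite -pure_iota.
  exact: ga_M.
apply: span_sub; exists g, 0, (pcl I x), one'; split=> //; rewrite ?addr0 //.
  by exists x.
by exists 1 => //; exact: ga_1.
Qed.
End Object.

Lemma iota_map (X Y : rhideal F) (YX : Y `<=` X) (y : subm Y) :
  tens_map S' (piece_map I YX) (iota Y y) = iota X (incl YX y).
Proof.
by rewrite [LHS]tens_map_pure piece_mapE.
Qed.
End PieceTensor.

(** * Tor between cyclic modules *)

Lemma sm_add_dec (K : pzRingType) (V : lmodType K) (W U : submod V) z :
  sm_add W U z <-> exists w u, [/\ W w, U u & z = w + u].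
Proof.
split=> [|[w [u [Ww Uu ->]]]]; last first.
  by apply: smD; apply: span_sub; [left|right].
pose D z := exists w u, [/\ W w, U u & z = w + u].
have D0 : D 0 by exists 0, 0; split; rewrite ?addr0 //; exact: sm_0.
have Dlin k x y : D x -> D y -> D (k *: x + y).
  move=> [a [b [Wa Ub ->]]] [c [d [Wc Ud ->]]].
  exists (k *: a + c), (k *: b + d); split; try exact: sm_lin.
  by rewrite scalerDr addrACA.
apply: (_ : (sm_add W U `<=` Submod D0 Dlin)) => {}z; apply=> x [Wx|Ux].
  by exists x, 0; split; rewrite ?addr0 //; exact: sm_0.
by exists 0, x; split; rewrite ?add0r //; exact: sm_0.
Qed.

Lemma sm_addS (K : pzRingType) (V : lmodType K) (W W' U U' : submod V) :
  W `<=` W' -> U `<=` U' -> sm_add W U `<=` sm_add W' U'.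
Proof.
move=> WW' UU' z /sm_add_dec[w [u [Ww Uu e]]]; apply/sm_add_dec.
by exists w, u; split=> //; [exact: WW'|exact: UU'].
Qed.

Section TorPieces.
Variables (K : comPzRingType) (G : zmodType) (F : galg K G).
Variables (I : hideal F) (J : rhideal F) (J' : lhideal F).
Hypotheses (IJ : I `<=` J) (IJ' : I `<=` J').
Hypotheses (qF : quasi_free F) (rI : relproj I) (rJ : relproj J).
Local Notation X := (gr_ideal I J).
Local Notation S' := (quot_lgmod IJ').
Local Notation Q := (gr_resolution IJ qF rI rJ).

(** An element of [X (n + 1)] gives a cycle when its image in [X n / X n J'] is
    zero, and an element of [X n] gives a boundary when it differs from one of
    [X (n + 1)] by one of [X n J']. *)
Lemma tor_gr_resolution n (Nm Dn : submod F) :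
  (forall x, Nm x <->
     X n x /\ (if n is m.+1 then sm_mul (X m) J' x else True)) ->
  (forall x, Dn x <-> sm_add (X n.+1) (sm_mul (X n) J') x) ->
  graded_iso (tor Q S' n) (gsubquot (ga_comp F) Nm Dn).
Proof.
move=> hN hD; apply: graded_isoI => g.
pose R (t : tens (piece I (X n)) S') (x : F) :=
  exists2 y : subm (X n), val y = x & iota IJ' (X n) y = t.
have cycE (y : subm (X n)) : tor_cycles Q S' n (iota IJ' (X n) y) <-> Nm (val y).
  rewrite hN; case: n y {R hN hD Nm Dn} => [|m] y.
    by split=> // _; split=> //; exact: submP.
  rewrite -[tor_cycles _ _ _ _]/(tens_map S' (piece_map I _) _ = 0).
  rewrite iota_map iota_eq0.
  by split=> [H|[]] //; split=> //; exact: submP.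
have bdE (y : subm (X n)) : tor_boundaries Q S' n (iota IJ' (X n) y) <-> Dn (val y).
  rewrite hD sm_add_dec; split.
    move=> [u _]; have [z <-] := iota_surj u.
    rewrite [tens_map _ _ _]iota_map => e.
    exists (val z), (val y - val z); split; first exact: submP.
      have : iota IJ' (X n) (y - incl (gr_ideal_sub IJ (n := n)) z) = 0.
        by rewrite linearB e subrr.
      by move/iota_eq0.
    by rewrite addrC subrK.
  move=> [a [b [Xa XJb e]]].
  exists (iota IJ' (X n.+1) (insm Xa)) => //; rewrite [LHS]iota_map.
  apply/eqP; rewrite -subr_eq0 -linearB; apply/eqP/iota_eq0.
  rewrite -[val _]/(a - val y) e opprD addrA subrr sub0r; exact: smN.
apply: (@subquot_iso _ _ _ _ _ _ _ R).
- move=> k s t x y [u <- <-] [v <- <-].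
  by exists (k *: u + v); rewrite ?linearP.
- move=> t [Zt /iota_comp[y Cy et]]; subst t; exists (val y); last by exists y.
  by split=> //; exact/cycE.
- move=> x [Nx Cx]; have [Xx _] := (hN x).1 Nx.
  exists (iota IJ' (X n) (insm Xx)); last by exists (insm Xx).
  by split; [exact/cycE|apply/iota_comp; exists (insm Xx)].
- move=> t x [_ Ct] [_ Cx] [y ey et]; subst t x.
  by split=> -[B _]; split=> //; exact/bdE.
Qed.
End TorPieces.

Theorem theorem2p9 (K : comPzRingType) (G : zmodType) (F : galg K G)
  (hF : quasi_free F)
  (I : hideal F) (J : rhideal F) (J' : lhideal F)
  (IJ : (I `<=` J)%classic) (IJ' : (I `<=` J')%classic)
  (projI : projective_mod (quotm I)) (projJ : projective_mod (quotm J))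
  (P : gresolution (quot_rgmod IJ)) (n : nat) :
  graded_iso (tor P (quot_lgmod IJ') n.*2)
    (gsubquot (ga_comp F) (even_num I J J' n) (even_den I J J' n))
  /\ graded_iso (tor P (quot_lgmod IJ') n.*2.+1)
    (gsubquot (ga_comp F) (odd_num I J J' n) (odd_den I J J' n)).
Proof.
have rI : relproj I := projective_relproj (@hi_hom _ _ _ I) projI.
have rJ : relproj J := projective_relproj (@rhi_hom _ _ _ J) projJ.
have ev m x : gr_ideal I J m.*2 x <-> sm_exp I m x by exact: gr_ideal_even.
have od m x : gr_ideal I J m.*2.+1 x <-> sm_mul J (sm_exp I m) x.
  exact: gr_ideal_odd.
split; apply: graded_iso_trans (tor_indep _ P (gr_resolution IJ hF rI rJ) _) _;
  apply: tor_gr_resolution => x.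
- case: n => [|n]; first by split.
  split=> -[Ix H]; split; try exact/ev; move: H.
    by apply: sm_mulS => // y /od.
  by apply: sm_mulS => // y /od.
- by split; apply: sm_addS => [y /od|] //; apply: sm_mulS => // y /ev.
- by split=> -[Jx H]; split; try exact/od; move: H; apply: sm_mulS => // y /ev.
- split; apply: sm_addS => [y H|].
  + exact/(ev n.+1).
  + by apply: sm_mulS => // y /od.
  + exact/(ev n.+1).
  + by apply: sm_mulS => // y /od.
Qed.
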